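(* Given a set $S$ of $n\ge 2$ points in the plane, there always exist two curves $P,Q$ that partition $S$ such that $d_{dF}(P,Q)\le \sqrt{3}\cdot\varepsilon^*$ and $\max\{|P|,|Q|\}=\lceil n/2\rceil$. Moreover, such curves can be found in $O(n\log n)$ time.
   Context: A (polygonal) curve is given by its finite non-empty sequence of vertices; $|P|$ denotes the number of vertices of $P$. Two curves $P,Q$ partition a finite point set $S$ if there is a partition of $S$ into two sets $A,B$ such that the vertex set of $P$ is exactly $A$, the vertex set of $Q$ is exactly $B$, and each point of $S$ is used exactly once (either in $P$ or in $Q$). A paired-walk along $P$ and $Q$ is a sequence of pairs $\pi=\{(P_i,Q_i)\}_{i=1}^k$ such that $P_1,\dots,P_k$ and $Q_1,\dots,Q_k$ partition the vertex sequences of $P$ and $Q$, respectively, in order, into disjoint non-empty contiguous subsequences, and for every $i$ either $|P_i|=1$ or $|Q_i|=1$. Its cost is $\max_i\max_{(p,q)\in P_i\times Q_i}\|p-q\|$. The discrete Fréchet distance $d_{dF}(P,Q)$ is the minimum cost of a paired-walk along $P$ and $Q$. $\varepsilon^*$ denotes the minimum of $d_{dF}(P,Q)$ over all pairs of curves $P,Q$ that partition $S$. *)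

(* Defs.v *)
From mathcomp Require Import all_boot all_order all_algebra finmap.
From mathcomp Require Import boolp classical_sets reals.

Set Implicit Arguments.
Unset Strict Implicit.
Unset Printing Implicit Defensive.
Import Order.TTheory GRing.Theory Num.Theory.
Local Open Scope ring_scope.
Local Open Scope classical_set_scope.

Notation plane R := (R * R)%type.

Definition dist (R : realType) (p q : plane R) : R :=
  Num.sqrt ((p.1 - q.1) ^+ 2 + (p.2 - q.2) ^+ 2).

(* A curve is the sequence of its vertices. *)
Notation curve R := (seq (plane R)).

Definition partitions (R : realType) (P Q : curve R) (S : {fset plane R}) : Prop :=
  [/\ P != [::], Q != [::], uniq P, uniq Q
    & exists A B : {fset plane R},
        [/\ (A `|` B)%fset = S, (A `&` B)%fset = fset0, P =i A & Q =i B]].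

(* The i-th item of the list is the pair (P_i, Q_i). *)
Definition paired_walk (R : realType) (P Q : curve R)
    (w : seq (curve R * curve R)) : Prop :=
  [/\ flatten (unzip1 w) = P, flatten (unzip2 w) = Q
    & forall c, c \in w ->
        [/\ c.1 != [::], c.2 != [::] & size c.1 = 1%N \/ size c.2 = 1%N]].

(* Distances are nonnegative, so 0 is a neutral default for the maxima. *)
Definition walk_cost (R : realType) (w : seq (curve R * curve R)) : R :=
  \big[Num.max/0]_(c <- w)
    \big[Num.max/0]_(p <- c.1) \big[Num.max/0]_(q <- c.2) dist p q.

Definition walk_costs (R : realType) (P Q : curve R) : set R :=
  [set walk_cost w | w in [set w | paired_walk P Q w]].

(* [inf] is the infimum; [ddF_min] below shows that it is a minimum. *)
Definition ddF (R : realType) (P Q : curve R) : R := inf (walk_costs P Q).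

Definition partition_ddFs (R : realType) (S : {fset plane R}) : set R :=
  [set x | exists P Q, partitions P Q S /\ x = ddF P Q].

(* Again a minimum, by [eps_star_min]. *)
Definition eps_star (R : realType) (S : {fset plane R}) : R :=
  inf (partition_ddFs S).

Definition balanced_approx (R : realType) (S : {fset plane R}) (P Q : curve R) :
    Prop :=
  [/\ partitions P Q S, ddF P Q <= Num.sqrt 3 * eps_star S
    & maxn (size P) (size Q) = uphalf #|` S|].

(* A real RAM.

   Programs over natural-number and real variables and over unbounded arrays of
   each sort; variables and arrays are named by numerals occurring in the
   program, hence there are finitely many of them in a given program, while the
   index of an array access is computed at run time.  Reals are exact and only
   accessible through field operations and comparisons: there is no square root
   and no rounding or other conversion from reals to naturals.  Naturals have
   addition and truncated subtraction but no multiplication, so that unit cost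
   is reasonable for them.  Every constant, variable or array access,
   operation, comparison, assignment and test costs one unit. *)

Inductive nexp :=
| NConst of nat
| NVar of nat
| NGet of nat & nexp            (* array, index *)
| NAdd of nexp & nexp
| NSub of nexp & nexp.

Inductive rexp :=
| RConst of nat
| RVar of nat
| RGet of nat & nexp            (* array, index *)
| RAdd of rexp & rexp
| RSub of rexp & rexp
| RMul of rexp & rexp
| RDiv of rexp & rexp.

Inductive bexp :=
| BNLt of nexp & nexp
| BRLt of rexp & rexp
| BNot of bexp
| BAnd of bexp & bexp.

Inductive cmd :=
| Skip
| NSet of nat & nexp            (* variable, value *)
| NPut of nat & nexp & nexp     (* array, index, value *)
| RSet of nat & rexp            (* variable, value *)
| RPut of nat & nexp & rexp     (* array, index, value *)
| Seq of cmd & cmd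
| If of bexp & cmd & cmd
| While of bexp & cmd.

Record state (R : realType) := State {
  nvar : nat -> nat;
  narr : nat -> nat -> nat;
  rvar : nat -> R;
  rarr : nat -> nat -> R }.

Definition upd (T : Type) (f : nat -> T) (x : nat) (v : T) : nat -> T :=
  fun y => if y == x then v else f y.

Definition set_nvar (R : realType) (s : state R) x v :=
  State (upd (nvar s) x v) (narr s) (rvar s) (rarr s).
Definition set_narr (R : realType) (s : state R) a i v :=
  State (nvar s) (upd (narr s) a (upd (narr s a) i v)) (rvar s) (rarr s).
Definition set_rvar (R : realType) (s : state R) x v :=
  State (nvar s) (narr s) (upd (rvar s) x v) (rarr s).
Definition set_rarr (R : realType) (s : state R) a i v :=
  State (nvar s) (narr s) (rvar s) (upd (rarr s) a (upd (rarr s a) i v)).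

Fixpoint neval (R : realType) (s : state R) (e : nexp) : nat :=
  match e with
  | NConst k => k
  | NVar x => nvar s x
  | NGet a e1 => narr s a (neval s e1)
  | NAdd e1 e2 => (neval s e1 + neval s e2)%N
  | NSub e1 e2 => (neval s e1 - neval s e2)%N
  end.

Fixpoint reval (R : realType) (s : state R) (e : rexp) : R :=
  match e with
  | RConst k => k%:R
  | RVar x => rvar s x
  | RGet a e1 => rarr s a (neval s e1)
  | RAdd e1 e2 => reval s e1 + reval s e2
  | RSub e1 e2 => reval s e1 - reval s e2
  | RMul e1 e2 => reval s e1 * reval s e2
  | RDiv e1 e2 => reval s e1 / reval s e2
  end.

Fixpoint beval (R : realType) (s : state R) (b : bexp) : bool :=
  match b with
  | BNLt e1 e2 => (neval s e1 < neval s e2)%N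
  | BRLt e1 e2 => reval s e1 < reval s e2
  | BNot b1 => ~~ beval s b1
  | BAnd b1 b2 => beval s b1 && beval s b2
  end.

Fixpoint ncost (e : nexp) : nat :=
  match e with
  | NConst _ | NVar _ => 1
  | NGet _ e1 => (ncost e1).+1
  | NAdd e1 e2 | NSub e1 e2 => (ncost e1 + ncost e2).+1
  end.

Fixpoint rcost (e : rexp) : nat :=
  match e with
  | RConst _ | RVar _ => 1
  | RGet _ e1 => (ncost e1).+1
  | RAdd e1 e2 | RSub e1 e2 | RMul e1 e2 | RDiv e1 e2 =>
      (rcost e1 + rcost e2).+1
  end.

Fixpoint bcost (b : bexp) : nat :=
  match b with
  | BNLt e1 e2 => (ncost e1 + ncost e2).+1
  | BRLt e1 e2 => (rcost e1 + rcost e2).+1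
  | BNot b1 => (bcost b1).+1
  | BAnd b1 b2 => (bcost b1 + bcost b2).+1
  end.

(* [exec c s t s']: started in [s], the program [c] halts in [s'] after [t] units
   of time.  It is deterministic, see [exec_det]. *)
Inductive exec (R : realType) : cmd -> state R -> nat -> state R -> Prop :=
| ExecSkip s :
    exec Skip s 1 s
| ExecNSet x e s :
    exec (NSet x e) s (ncost e).+1 (set_nvar s x (neval s e))
| ExecNPut a e1 e2 s :
    exec (NPut a e1 e2) s (ncost e1 + ncost e2).+1
      (set_narr s a (neval s e1) (neval s e2))
| ExecRSet x e s :
    exec (RSet x e) s (rcost e).+1 (set_rvar s x (reval s e))
| ExecRPut a e1 e2 s :
    exec (RPut a e1 e2) s (ncost e1 + rcost e2).+1
      (set_rarr s a (neval s e1) (reval s e2))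
| ExecSeq c1 c2 s1 s2 s3 t1 t2 :
    exec c1 s1 t1 s2 -> exec c2 s2 t2 s3 ->
    exec (Seq c1 c2) s1 (t1 + t2) s3
| ExecIf b c1 c2 s s' t :
    exec (if beval s b then c1 else c2) s t s' ->
    exec (If b c1 c2) s (bcost b + t).+1 s'
| ExecWhileFalse b c s :
    ~~ beval s b -> exec (While b c) s (bcost b).+1 s
| ExecWhileTrue b c s1 s2 s3 t1 t2 :
    beval s1 b -> exec c s1 t1 s2 -> exec (While b c) s2 t2 s3 ->
    exec (While b c) s1 (bcost b + t1 + t2).+1 s3.

(* Variable 0 holds the number of points, real arrays 0 and 1 their coordinates;
   all other memory is zero. *)
Definition input_state (R : realType) (pts : seq (plane R)) : state R :=
  State (upd (fun=> 0%N) 0 (size pts)) (fun _ _ => 0%N) (fun=> 0)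
    (upd (upd (fun _ _ => 0) 0 (fun i => (nth (0, 0) pts i).1))
       1 (fun i => (nth (0, 0) pts i).2)).

(* The first curve is read off variable 1 (number of vertices) and real arrays 2
   and 3 (coordinates), the second one off variable 2 and real arrays 4 and 5. *)
Definition output_fst (R : realType) (s : state R) : curve R :=
  mkseq (fun i => (rarr s 2 i, rarr s 3 i)) (nvar s 1).
Definition output_snd (R : realType) (s : state R) : curve R :=
  mkseq (fun i => (rarr s 4 i, rarr s 5 i)) (nvar s 2).

(* [trunc_log 2 n] is the integer part of the binary logarithm; it is at least 1
   for the relevant n. *)
Definition nlogn (n : nat) : nat := (n * trunc_log 2 n)%N.

Lemma exec_det (R : realType) c (s : state R) t1 s1 t2 s2 :
  exec c s t1 s1 -> exec c s t2 s2 -> t1 = t2 /\ s1 = s2.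
Proof.
move=> e; elim: e t2 s2 => {c s t1 s1}.
- by move=> s t2 s2 e; inversion e.
- by move=> x e0 s t2 s2 e; inversion e.
- by move=> a e0 e1 s t2 s2 e; inversion e.
- by move=> x e0 s t2 s2 e; inversion e.
- by move=> a e0 e1 s t2 s2 e; inversion e.
- move=> c1 c2 s1 s2 s3 t1 t2 _ IH1 _ IH2 t s e; inversion e as
    [| | | | |? ? ? s2' ? u1 u2 e1 e2| | |]; subst.
  have [? ?] := IH1 _ _ e1; subst.
  by have [-> ->] := IH2 _ _ e2.
- move=> b c1 c2 s s' t _ IH t2 s2 e; inversion e as
    [| | | | | |? ? ? ? ? u e1| |]; subst.
  by have [-> ->] := IH _ _ e1.
- move=> b c s nb t2 s2 e; inversion e as
    [| | | | | | | |? ? ? ? ? ? ? hb]; subst => //.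
  by rewrite hb in nb.
- move=> b c s1 s2 s3 t1 t2 hb _ IH1 _ IH2 t s e; inversion e as
    [| | | | | | |? ? ? nb|? ? ? s2' ? u1 u2 ? e1 e2]; subst.
    by rewrite hb in nb.
  have [? ?] := IH1 _ _ e1; subst.
  by have [-> ->] := IH2 _ _ e2.
Qed.

Lemma inf_is_min (R : realType) (A : set R) (l : seq R) :
  A !=set0 -> (forall x, A x -> x \in l) -> A (inf A) /\ lbound A (inf A).
Proof.
move=> [x0 Ax0] Al.
suff [m Am lbm] : exists2 m, A m & lbound A m.
  suff -> : inf A = m by [].
  apply/eqP; rewrite eq_le; apply/andP; split.
    by apply: ge_inf => //; exists m.
  by apply: lb_le_inf => //; exists x0.
elim: l A x0 Ax0 Al => [|y l IH] A x0 Ax0 Al; first by have := Al _ Ax0.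
pose B := [set x | A x /\ x <> y].
have [[z Bz]|nB] := pselect (exists z, B z).
  have [|m [Am _] lbm] := IH B z Bz.
    by move=> x [/Al]; rewrite inE => /orP[/eqP|].
  have [Ay|nAy] := pselect (A y); last first.
    exists m => // x Ax; apply: lbm; split=> // xy; apply: nAy; by rewrite -xy.
  have [my|ym] := leP m y.
    exists m => // x Ax.
    by have [->//|xy] := pselect (x = y); apply: lbm.
  exists y => // x Ax.
  have [->//|xy] := pselect (x = y).
  by apply: (le_trans (ltW ym)); apply: lbm.
exists x0 => // x Ax.
have Ey z : A z -> z = y.
  by move=> Az; apply: contrapT => zy; apply: nB; exists z.
by rewrite (Ey _ Ax) (Ey _ Ax0).
Qed.

Lemma paired_walk_ex (R : realType) (P Q : curve R) :
  P != [::] -> Q != [::] -> exists w, paired_walk P Q w.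
Proof.
elim: P Q => [//|p P IH] [//|q Q] _ _.
have [->|P0] := eqVneq P [::].
  exists [:: ([:: p], q :: Q)]; split; rewrite /= ?cats0 // => c.
  by rewrite inE => /eqP -> /=; split => //; left.
have [->|Q0] := eqVneq Q [::].
  exists [:: (p :: P, [:: q])]; split; rewrite /= ?cats0 // => c.
  by rewrite inE => /eqP -> /=; split => //; right.
have [w [w1 w2 w3]] := IH Q P0 Q0.
exists (([:: p], [:: q]) :: w); split; rewrite /= ?w1 ?w2 // => c.
by rewrite inE => /orP[/eqP -> /=|/w3//]; split => //; left.
Qed.

Lemma walk_cost_in (R : realType) (P Q : curve R) x : walk_costs P Q x ->
  x \in 0 :: [seq dist p q | p <- P, q <- Q].
Proof.
set l := (X in _ \in X).
have l0 : 0 \in l by rewrite inE eqxx.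
have lmax u v : u \in l -> v \in l -> Num.max u v \in l.
  by rewrite /Num.max; case: ifP.
move=> [w [w1 w2 _] <-]; rewrite /walk_cost big_seq.
apply: (big_ind (fun y => y \in l)) => // c cw.
rewrite big_seq; apply: (big_ind (fun y => y \in l)) => // p pc.
rewrite big_seq; apply: (big_ind (fun y => y \in l)) => // q qc.
rewrite inE; apply/orP; right.
apply/allpairsP; exists (p, q); split=> //=.
  by rewrite -w1; apply/flattenP; exists c.1 => //; apply: map_f.
by rewrite -w2; apply/flattenP; exists c.2 => //; apply: map_f.
Qed.

Lemma ddF_min (R : realType) (P Q : curve R) : P != [::] -> Q != [::] ->
  walk_costs P Q (ddF P Q) /\ lbound (walk_costs P Q) (ddF P Q).
Proof.
move=> P0 Q0; apply: inf_is_min; last exact: walk_cost_in.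
by have [w Pw] := paired_walk_ex P0 Q0; exists (walk_cost w), w.
Qed.

Lemma eps_star_min (R : realType) (S : {fset plane R}) : (2 <= #|` S|)%N ->
  partition_ddFs S (eps_star S) /\ lbound (partition_ddFs S) (eps_star S).
Proof.
move=> S2; apply: (@inf_is_min _ _ (0 :: [seq dist p q | p <- S, q <- S])).
  have : enum_fset S =i S by [].
  have := fset_uniq S; have : (2 <= size S)%N by [].
  case: (enum_fset S) => [//|x [//|y s]] _ us eS.
  exists (ddF [:: x] (y :: s)), [:: x], (y :: s); split=> //.
  have /andP[xs us'] : (x \notin y :: s) && uniq (y :: s) by [].
  split => //; exists [fset x]%fset, [fset z in y :: s]%fset; split.
  - by apply/fsetP => z; rewrite -eS !inE.
  - apply/fsetP => z; rewrite in_fsetI in_fset1 in_fset0 in_fset /=.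
    by apply/negP => /andP[/eqP-> xin]; move: xs; rewrite xin.
  - by move=> z; rewrite !inE.
  - by move=> z; rewrite in_fset.
move=> _ [P [Q [[P0 Q0 _ _ [A [B [AB _ PA QB]]]] ->]]].
have [/walk_cost_in + _] := ddF_min P0 Q0.
rewrite !inE => /orP[->//|/allpairsP[[p q] [/= pP qQ ->]]].
apply/orP; right; apply/allpairsP; exists (p, q); split=> //=.
  by rewrite -AB in_fsetU -PA pP.
by rewrite -AB in_fsetU -QB qQ orbT.
Qed.

(* Main.v *)
Require Import Defs.
From mathcomp Require Import all_boot all_order all_algebra finmap.
From mathcomp Require Import boolp classical_sets reals.
From mathcomp Require Import zify ring lra.

(* Every point is matched to a point of the other curve, so eps* is at least the
   largest nearest-neighbour distance, and in the nearest-neighbour graph all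
   edges have length at most eps*.  A greedy matching of this graph, to which
   the unmatched points are attached as leaves, covers the points by stars.  Of
   three leaves of a star, two are at distance at most sqrt 3 * eps*, because
   |x-u|^2 + |x-v|^2 + |u-v|^2 <= 3 (|x|^2 + |u|^2 + |v|^2) for vectors x, u, v
   from the center; splitting off such pairs leaves stars with one or two leaves.
   Pairs contribute equally to P and Q, and alternating the orientation of the
   stars with two leaves keeps | |P| - |Q| | <= 1.

   All nearest neighbours are found by a merge sort by ordinate of the points
   presorted by abscissa.  Blocks on both sides of a vertical line are merged,
   each point p having a distance r(p) to its current candidate that is at most
   its distance to the points on its side.  A point q beyond the line and closer
   to p than r(p) projects on the line into the disc of radius r(p) around p, so p
   scans the merged block up and down as long as the projections are in its
   disc.  Among the points p on one side in a same octant around a point z of the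
   line, at most one has z in its disc; hence each projection is in at most
   8 + 8 discs and a merge takes linear time. *)

Set Implicit Arguments.
Unset Strict Implicit.
Unset Printing Implicit Defensive.
Import Order.TTheory GRing.Theory Num.Theory.

(** * Syntactic write sets *)

Fixpoint nwrites (c : cmd) (x : nat) : bool :=
  match c with
  | NSet y _ => x == y
  | Seq c1 c2 | If _ c1 c2 => nwrites c1 x || nwrites c2 x
  | While _ c1 => nwrites c1 x
  | _ => false
  end.

Fixpoint awrites (c : cmd) (a : nat) : bool :=
  match c with
  | NPut b _ _ => a == b
  | Seq c1 c2 | If _ c1 c2 => awrites c1 a || awrites c2 a
  | While _ c1 => awrites c1 a
  | _ => false
  end.

Fixpoint rwrites (c : cmd) (a : nat) : bool :=
  match c with
  | RPut b _ _ => a == b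
  | Seq c1 c2 | If _ c1 c2 => rwrites c1 a || rwrites c2 a
  | While _ c1 => rwrites c1 a
  | _ => false
  end.

(** * Total correctness with running time *)

Section Logic.
Variable R : realType.
Implicit Types (s : state R) (c : cmd).

(** Write sets are boolean functions, so the preservation of a concrete variable or array is proved
    by [isT]. *)
Definition frame c s s' : Prop :=
  [/\ forall x, ~~ nwrites c x -> nvar s' x = nvar s x,
      forall a, ~~ awrites c a -> narr s' a = narr s a
    & forall a, ~~ rwrites c a -> rarr s' a = rarr s a].

Lemma frame_refl c s : frame c s s. Proof. by []. Qed.

Lemma frame_trans c s1 s2 s3 : frame c s1 s2 -> frame c s2 s3 -> frame c s1 s3.
Proof.
move=> [n1 a1 r1] [n2 a2 r2]; split=> x xw; first by rewrite n2 // n1.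
- by rewrite a2 // a1.
- by rewrite r2 // r1.
Qed.

Lemma exec_frame c s t s' : exec c s t s' -> frame c s s'.
Proof.
elim=> {c s t s'} //.
- by move=> x e s; split=> //= y /negbTE xy; rewrite /upd xy.
- by move=> a e1 e2 s; split=> //= y /negbTE xy; rewrite /upd xy.
- by move=> a e1 e2 s; split=> //= y /negbTE xy; rewrite /upd xy.
- move=> c1 c2 s1 s2 s3 t1 t2 _ [n1 a1 r1] _ [n2 a2 r2].
  by split=> x /= /norP[xw1 xw2];
    [rewrite n2 ?n1|rewrite a2 ?a1|rewrite r2 ?r1].
- move=> b c1 c2 s s' t _; case: (beval s b) => -[n1 a1 r1];
  by split=> x /= /norP[xw1 xw2]; [rewrite n1|rewrite a1|rewrite r1].
- by move=> b c s1 s2 s3 t1 t2 _ _ f1 _ f2; exact: (frame_trans f1 f2).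
Qed.

(** As execution is deterministic, exhibiting one halting run suffices. The postcondition also
    receives the running time. *)
Definition wp c (Q : nat -> state R -> Prop) s : Prop :=
  exists t s', exec c s t s' /\ Q t s'.

(** The rule of consequence supplies the frame, so that specifications can omit the memory that a
    program does not write. *)
Lemma wp_mono c (Q Q' : nat -> state R -> Prop) s :
  (forall t s', frame c s s' -> Q t s' -> Q' t s') -> wp c Q s -> wp c Q' s.
Proof.
move=> QQ' [t [s' [e q]]]; exists t, s'; split=> //.
exact: (QQ' _ _ (exec_frame e)).
Qed.

Lemma wp_skip Q s : Q 1 s -> wp Skip Q s.
Proof. by move=> q; exists 1, s; split=> //; constructor. Qed.

Lemma wp_nset x e Q s :
  Q (ncost e).+1 (set_nvar s x (neval s e)) -> wp (NSet x e) Q s.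
Proof. by move=> q; do 2!eexists; split; [constructor|]. Qed.

Lemma wp_nput a e1 e2 Q s :
  Q (ncost e1 + ncost e2).+1 (set_narr s a (neval s e1) (neval s e2)) ->
  wp (NPut a e1 e2) Q s.
Proof. by move=> q; do 2!eexists; split; [constructor|]. Qed.

Lemma wp_rput a e1 e2 Q s :
  Q (ncost e1 + rcost e2).+1 (set_rarr s a (neval s e1) (reval s e2)) ->
  wp (RPut a e1 e2) Q s.
Proof. by move=> q; do 2!eexists; split; [constructor|]. Qed.

Lemma wp_seq c1 c2 Q s :
  wp c1 (fun t1 s1 => wp c2 (fun t2 => Q (t1 + t2)) s1) s ->
  wp (Seq c1 c2) Q s.
Proof.
move=> [t1 [s1 [e1 [t2 [s2 [e2 q]]]]]].
by exists (t1 + t2), s2; split=> //; apply: ExecSeq e1 e2.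
Qed.

Lemma wp_if b c1 c2 Q s :
  (beval s b -> wp c1 (fun t => Q (bcost b + t).+1) s) ->
  (~~ beval s b -> wp c2 (fun t => Q (bcost b + t).+1) s) ->
  wp (If b c1 c2) Q s.
Proof.
move=> h1 h2; have [t [s' [e q]]] :
    wp (if beval s b then c1 else c2) (fun t => Q (bcost b + t).+1) s.
  by case: ifPn.
by exists (bcost b + t).+1, s'; split=> //; constructor.
Qed.

(* The index [T] of the invariant is a potential that pays for the remaining
   iterations; as it decreases, it also ensures termination. *)
Lemma wp_while b c (I : nat -> state R -> Prop) T s :
  (forall T1 s1, frame c s s1 -> I T1 s1 -> beval s1 b ->
     wp c (fun t s2 => exists2 T2, I T2 s2 & t + T2 + (bcost b).+1 <= T1) s1) ->
  I T s ->
  wp (While b c)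
    (fun t s' => [/\ t <= T + (bcost b).+1, exists T', I T' s' & ~~ beval s' b]) s.
Proof.
move=> step; suff H s1 : frame c s s1 -> I T s1 ->
    wp (While b c)
    (fun t s' => [/\ t <= T + (bcost b).+1, exists T', I T' s' & ~~ beval s' b])
      s1 by apply: H; exact: frame_refl.
have [k] := ubnP T; elim: k T s1 => // k IH T s1 Tk fr i1.
have [b1|nb1] := boolP (beval s1 b); last first.
  exists (bcost b).+1, s1; split; first by constructor.
  by split=> //; [rewrite leq_addl|exists T].
have [t [s2 [e2 [T2 i2 le2]]]] := step _ _ fr i1 b1.
have [|t3 [s3 [e3 [le3 i3 nb3]]]] := IH T2 s2 _ (frame_trans fr (exec_frame e2)) i2.
  by lia.
exists (bcost b + t + t3).+1, s3; split; first exact: ExecWhileTrue e2 e3.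
by split=> //; lia.
Qed.

End Logic.

(** * Bottom-up divide and conquer *)

Definition seg (T : Type) (f : nat -> T) (a b : nat) : seq T :=
  map f (index_iota a b).

Section Seg.
Variables (T : eqType).
Implicit Types (f g : nat -> T).

Lemma seg_nil f a b : b <= a -> seg f a b = [::].
Proof. by rewrite /seg /index_iota -subn_eq0 => /eqP ->. Qed.

Lemma seg_cons f a b : a < b -> seg f a b = f a :: seg f a.+1 b.
Proof.
rewrite /seg /index_iota => ab.
by have -> : b - a = (b - a.+1).+1 by lia.
Qed.

Lemma seg_cat f a m b : a <= m <= b -> seg f a b = seg f a m ++ seg f m b.
Proof.
move=> amb; rewrite /seg /index_iota -map_cat.
have -> : b - a = (m - a) + (b - m) by lia.
by rewrite iotaD; have -> : a + (m - a) = m by lia.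
Qed.

Lemma seg_rcons f a b : a <= b -> seg f a b.+1 = rcons (seg f a b) (f b).
Proof.
move=> ab; rewrite (@seg_cat f a b) ?ab ?leqnSn // (@seg_cons f b) //.
by rewrite (@seg_nil f b.+1) // cats1.
Qed.

Lemma eq_seg f g a b :
  (forall i, a <= i < b -> f i = g i) -> seg f a b = seg g a b.
Proof. by move=> fg; apply/eq_in_map => i; rewrite mem_index_iota => /fg. Qed.

Lemma mem_seg f a b x :
  reflect (exists2 i, a <= i < b & x = f i) (x \in seg f a b).
Proof.
apply: (iffP mapP) => -[i]; rewrite ?mem_index_iota => ib ->;
  by exists i; rewrite ?mem_index_iota.
Qed.

Lemma size_seg f a b : size (seg f a b) = b - a.
Proof. by rewrite size_map size_iota. Qed.

Lemma nth_seg x0 f a b i : i < b - a -> nth x0 (seg f a b) i = f (a + i).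
Proof.
by move=> ib; rewrite (nth_map 0) ?size_iota // /index_iota nth_iota.
Qed.

Lemma sorted_seg (le : rel T) f a b i j : transitive le -> reflexive le ->
  sorted le (seg f a b) -> a <= i <= j -> j < b -> le (f i) (f j).
Proof.
move=> tr rf so aij jb.
have ai : i - a < b - a by lia.
have aj : j - a < b - a by lia.
have := @sorted_leq_nth _ _ tr rf (f i) _ so (i - a) (j - a).
rewrite !inE size_seg !nth_seg //.
have -> : a + (i - a) = i by lia.
have -> : a + (j - a) = j by lia.
by move=> /(_ ai aj); apply; lia.
Qed.

Lemma uniq_seg_inj f a b i j : uniq (seg f a b) ->
  a <= i < b -> a <= j < b -> f i = f j -> i = j.
Proof.
move=> u ib jb fij.
have ai : i - a < b - a by lia.
have aj : j - a < b - a by lia.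
have := @nth_uniq _ (f i) (seg f a b) (i - a) (j - a).
rewrite size_seg !nth_seg //.
have -> : a + (i - a) = i by lia.
have -> : a + (j - a) = j by lia.
by rewrite fij eqxx => /(_ ai aj u) /esym/eqP; lia.
Qed.

End Seg.

(** Pigeonhole principle; the keys will be the octants around a point. *)
Lemma count_le_keys (T : eqType) (K : finType) (key : T -> K) (P : pred T)
    (s : seq T) : uniq s ->
  {in s &, forall x y, P x -> P y -> key x = key y -> x = y} ->
  count P s <= #|K|.
Proof.
move=> us inj; rewrite -size_filter -(size_map key).
have u : uniq [seq key x | x <- s & P x].
  rewrite map_inj_in_uniq ?filter_uniq // => x y.
  rewrite !mem_filter => /andP[Px xs] /andP[Py ys]; exact: inj.
by rewrite -(card_uniqP u) max_card.
Qed.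

(** A sweep is charged for [up_log 2 n] passes, whereas [nlogn] rounds the logarithm down; the
    factor 2 absorbs the difference. *)
Lemma up_log_le_trunc_log n : 1 < n -> up_log 2 n <= 2 * trunc_log 2 n.
Proof.
move=> n1; have : up_log 2 n <= (trunc_log 2 n).+1.
  by apply: up_log_min => //; apply/ltnW/trunc_log_ltn.
have : 0 < trunc_log 2 n by rewrite trunc_log_gt0.
by lia.
Qed.

Section Sweep.
Variable R : realType.
Implicit Types (s : state R).

(* Memory layout: [NVar 3] is the width of the blocks; the blocks being merged
   are the positions from [NVar 4] to [NVar 5] and from [NVar 5] to [NVar 6],
   upper bounds excluded; [NVar 7] to [NVar 11] are scratch variables.  Natural
   array 0 lists the points in their current order, 1 is the target of merges,
   2 lists the points by abscissa, 3 holds the nearest neighbours, 4 the mates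
   and 5 and 6 up to two leaves of each point; in 4, 5 and 6 the value [k.+1]
   stands for the point [k] and 0 for none. *)
Definition sweepC (body : cmd) : cmd :=
  Seq (NSet 3 (NConst 1))
  (While (BNLt (NVar 3) (NVar 0))
    (Seq (NSet 4 (NConst 0))
    (Seq (While (BNLt (NAdd (NVar 4) (NVar 3)) (NVar 0))
      (Seq (NSet 5 (NAdd (NVar 4) (NVar 3)))
      (Seq (NSet 6 (NAdd (NVar 5) (NVar 3)))
      (Seq (If (BNLt (NVar 0) (NVar 6)) (NSet 6 (NVar 0)) Skip)
      (Seq body
           (NSet 4 (NAdd (NAdd (NVar 4) (NVar 3)) (NVar 3))))))))
    (NSet 3 (NAdd (NVar 3) (NVar 3)))))).

(* [G] is a global invariant and [B] the invariant of a sorted block. *)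
Variables (n K : nat) (body : cmd).
Variables (G : (nat -> nat -> nat) -> (nat -> nat -> R) -> Prop).
Variables (B : nat -> nat -> (nat -> nat -> nat) -> Prop).
Hypothesis body_vars : forall x, x < 7 -> ~~ nwrites body x.
Hypothesis bodyP : forall s a mid hi, nvar s 0 = n ->
  nvar s 4 = a -> nvar s 5 = mid -> nvar s 6 = hi ->
  a < mid < hi -> hi <= n -> G (narr s) (rarr s) ->
  B a mid (narr s) -> B mid hi (narr s) ->
  wp body (fun t s' => [/\ t <= K * (hi - a), G (narr s') (rarr s'),
    B a hi (narr s')
  & forall b c, b < c -> c <= a \/ (hi <= b /\ c <= n) ->
      B b c (narr s) -> B b c (narr s')]) s.

(** Blocks are selected by the position where they begin; the last one may be cut at [n]. *)
Definition blocks w lo hi (na : nat -> nat -> nat) : Prop :=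
  forall k, lo <= k * w < hi -> B (k * w) (minn (k * w + w) n) na.

(** After [k] passes the width is [2 ^ k], and the potential pays for [up_log 2 n - k] further
    passes. Within a pass, each position pays once, for the merge that covers it. *)
Lemma wp_sweep s : nvar s 0 = n -> 1 < n -> G (narr s) (rarr s) ->
  (forall i, i < n -> B i i.+1 (narr s)) ->
  wp (sweepC body) (fun t s' => [/\ t <= 2 * (K + 100) * n * trunc_log 2 n + 10,
     G (narr s') (rarr s') & B 0 n (narr s')]) s.
Proof.
move=> s0 n1 Gs Bs; apply: wp_seq; apply: wp_nset => /=.
pose I T s1 := [/\ G (narr s1) (rarr s1),
  exists2 k, nvar s1 3 = 2 ^ k & T = (K + 100) * n * (up_log 2 n - k)
  & blocks (nvar s1 3) 0 n (narr s1)].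
have wsw x : x < 7 -> nwrites body x = false by move=> x7; apply/negbTE/body_vars.
apply: (wp_mono _ (wp_while (I := I) (T := (K + 100) * n * up_log 2 n) _ _)).
- move=> t s' [/(_ 0)/= + _ _].
  rewrite wsw // => /(_ isT) s'0 [le [T' [Gs' [k w3 _] bl]] ].
  rewrite /= -leqNgt => nw; rewrite /upd /= s0 in s'0.
  split => //; last first.
    have := bl 0; rewrite mul0n add0n; have -> : minn (nvar s' 3) n = n by lia.
    by apply; lia.
  have := leq_mul (leqnn ((K + 100) * n)) (up_log_le_trunc_log n1).
  by move: le => /=; lia.
- move=> T1 s1 [/(_ 0)/= + _ _]; rewrite wsw // => /(_ isT) s10.
  rewrite /upd /= s0 in s10; move=> [Gs1 [k w3 ->] bl]; rewrite /= s10 => wn.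
  set w := nvar s1 3 in w3 bl wn.
  have w0 : 0 < w by rewrite w3 expn_gt0.
  apply: wp_seq; apply: wp_nset => /=.
  (* Blocks before [nvar s2 4] already have the doubled width, the others still have width [w]. *)
  pose J T s2 := [/\ G (narr s2) (rarr s2),
    exists2 c, nvar s2 4 = c * (w + w) & T = (K + 40) * (n - nvar s2 4),
    blocks (w + w) 0 (nvar s2 4) (narr s2) & blocks w (nvar s2 4) n (narr s2)].
  apply: wp_seq.
  apply: (wp_mono _ (wp_while (I := J) (T := (K + 40) * n) _ _)).
  + move=> t s2 [+ _ _] [le [T2 [Gs2 [c a4 _] bl1 bl2]]]; rewrite /= -leqNgt.
    move=> fr; have := fr 0; have := fr 3; rewrite /= !wsw //.
    move=> /(_ isT) s23 /(_ isT) s20; rewrite s20 s23 /upd /= -/w s10 => an.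
    apply: wp_nset => /=; exists ((K + 100) * n * (up_log 2 n - k.+1)).
      split => //=; rewrite /upd /= s23 /upd /= -/w.
        by exists k.+1 => //; rewrite w3 expnS; lia.
      move=> j /andP[_ jn].
      have [ja|aj] := ltnP (j * (w + w)) (nvar s2 4); first by apply: bl1; lia.
      (* A last block without a partner reaches [n], so it also counts as a block of the doubled
         width. *)
      have -> : minn (j * (w + w) + (w + w)) n = minn ((2 * j) * w + w) n by nia.
      have -> : j * (w + w) = (2 * j) * w by nia.
      by apply: bl2; nia.
    have kn : k < up_log 2 n.
      rewrite ltnNge; apply/negP => uk.
      have := @up_logP 2 n isT.
      by have := @leq_pexp2l 2 _ _ isT uk; lia.
    have -> : up_log 2 n - k = (up_log 2 n - k.+1).+1 by lia.
    by move: le => /=; rewrite mulnS; nia.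
  + move=> T2 s2 [+ _ _] [Gs2 [c a4 ->] bl1 bl2] /=.
    move=> fr; have := fr 0; have := fr 3; rewrite /= !wsw //.
    rewrite /upd /= -/w s10 => /(_ isT) s23 /(_ isT) s20.
    rewrite s23 s20 => an; set a := nvar s2 4 in a4 bl1 bl2 an *.
    apply: wp_seq; apply: wp_nset => /=; apply: wp_seq; apply: wp_nset => /=.
    apply: wp_seq; rewrite /set_nvar /= /upd /=.
    pose hi := minn (a + w + w) n.
    (* Whether or not the second block is cut at [n], the resulting states agree on what matters
       below; the rest is proved once for both branches. *)
    suff body_ok s3 t3 : t3 <= 10 -> nvar s3 0 = n -> nvar s3 3 = w ->
        nvar s3 4 = a -> nvar s3 5 = a + w -> nvar s3 6 = hi ->
        narr s3 = narr s2 -> rarr s3 = rarr s2 ->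
        wp (Seq body (NSet 4 (NAdd (NAdd (NVar 4) (NVar 3)) (NVar 3))))
         (fun t s' => exists2 T3, J T3 s'
            & t3 + t + 8 + T3 + 10 <= (K + 40) * (n - a)) s3.
      apply: wp_if; rewrite /= /upd /= ?s20 ?s23 -?/a => hin; [apply: wp_nset|apply: wp_skip] => /=;
      (apply: wp_mono; last (apply: (body_ok _ 10) => //; rewrite /= /upd /= ?s23 ?s20 // /hi; lia));
      by move=> t s' _ [T3 J3 le3]; exists T3 => //=; move: le3 => /=; lia.
    move=> t310 s30 s33 s34 s35 s36 an3 rn3; apply: wp_seq.
    apply: (wp_mono _ (@bodyP s3 a (a + w) hi s30 s34 s35 s36 _ _ _ _ _)).
    * move=> t s4 [fr4 _ _] [le4 Gs4 Bs4 oth]; apply: wp_nset => /=.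
      have s40 : nvar s4 0 = n by rewrite fr4 ?body_vars.
      have s44 : nvar s4 4 = a by rewrite fr4 ?body_vars.
      have s43 : nvar s4 3 = w by rewrite fr4 ?body_vars.
      rewrite s44 s43; exists ((K + 40) * (n - (a + w + w))).
        split => //=; rewrite /upd /=; first by exists c.+1 => //; lia.
          move=> j /andP[_ ja].
          have [ja'|aj'] := ltnP (j * (w + w)) a.
            have jc : j.+1 <= c.
              by move: ja'; rewrite a4 ltn_pmul2r ?addn_gt0 ?w0.
            have := leq_mul jc (leqnn (w + w)); rewrite mulSn -a4 => jc'.
            by apply: oth; [lia|left; lia|rewrite an3; apply: bl1; lia].
          have jc : j = c.
            have : j < c.+1.
              by rewrite -(@ltn_pmul2r (w + w)) ?addn_gt0 ?w0 // mulSn -a4; lia.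
            by move: aj'; rewrite a4 leq_pmul2r ?addn_gt0 ?w0 //; lia.
          subst j; rewrite -a4; have -> : minn (a + (w + w)) n = hi by lia.
          by [].
        move=> j jb; apply: oth; [lia|right; lia|rewrite an3; apply: bl2; lia].
      have : n - a = (n - (a + w + w)) + (hi - a) by lia.
      by move: le4; nia.
    * by lia.
    * by lia.
    * by rewrite an3 rn3.
    * rewrite an3; have := bl2 (2 * c); have -> : 2 * c * w = a by lia.
      have -> : minn (a + w) n = a + w by lia.
      by apply; rewrite leqnn /=; lia.
    * rewrite an3; have := bl2 (2 * c).+1; have -> : (2 * c).+1 * w = a + w by lia.
      rewrite -/hi => H; apply: H; rewrite leq_addr /=; lia.
  + split => //=; rewrite /upd /=.
    by exists 0 => //; rewrite subn0.
- split => //=; rewrite /upd /=; first by exists 0; rewrite ?subn0.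
  move=> j; rewrite !muln1 => jn; have -> : minn (j + 1) n = j.+1 by lia.
  by apply: Bs; lia.
Qed.
End Sweep.

(** * Copying and merging blocks *)

Section Merge.
Variable R : realType.
Implicit Types (s : state R).

Definition copyC (dst src : nat) (lo : nexp) (h : nat) : cmd :=
  Seq (NSet 9 lo)
  (While (BNLt (NVar 9) (NVar h))
    (Seq (NPut dst (NVar 9) (NGet src (NVar 9)))
         (NSet 9 (NAdd (NVar 9) (NConst 1))))).

Lemma wp_copy dst src lo h s : h != 9 -> dst != src -> ncost lo <= 1 ->
  neval s lo <= nvar s h ->
  wp (copyC dst src lo h) (fun t s' => t <= 20 * (nvar s h - neval s lo) + 20 /\
     forall i, narr s' dst i =
       if neval s lo <= i < nvar s h then narr s src i else narr s dst i) s.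
Proof.
move=> h9 ds lo1; set a := neval s lo; set hi := nvar s h => ahi.
apply: wp_seq; apply: wp_nset.
have ew (x : nat) (y : nat -> nat) : upd y 9 x h = y h by rewrite /upd (negbTE h9).
pose I T s1 := [/\ a <= nvar s1 9 <= hi, T = 20 * (hi - nvar s1 9)
 & forall i, narr s1 dst i =
     if a <= i < nvar s1 9 then narr s src i else narr s dst i].
apply: (wp_mono _ (wp_while (I := I) (T := 20 * (hi - a)) _ _)).
- move=> t s' [/(_ h)/= + _ _].
  rewrite (negbTE h9) ew => /(_ isT) s'h.
  move=> [le [T' [b9 _ H]]]; rewrite /= s'h -leqNgt -/hi => hi9.
  split; first by move: le => /=; lia.
  by move=> i; rewrite H; have -> : nvar s' 9 = hi by lia.
- move=> T s1 [/(_ h)/= + /(_ src)/= + _].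
  rewrite (negbTE h9) ew => /(_ isT) s1h.
  rewrite eq_sym orbF => /(_ ds) s1s [b9 -> H] /=; rewrite s1h -/hi => lt9.
  apply: wp_seq; apply: wp_nput; apply: wp_nset => /=; rewrite /upd /=.
  exists (20 * (hi - (nvar s1 9).+1)); last by lia.
  split => /=; rewrite /upd /= ?addn1 //; first by lia.
  move=> i; rewrite eqxx s1s; case: eqP => [->|ni]; first by rewrite ifT //; lia.
  by rewrite H; congr (if _ then _ else _); lia.
- split => /=; rewrite /upd /=; [by lia|by []|].
  by move=> i; rewrite ifF //; lia.
Qed.

Definition mergeC (key : nat) : cmd :=
  Seq (NSet 7 (NVar 4)) (Seq (NSet 8 (NVar 5)) (Seq (NSet 9 (NVar 4))
  (While (BNLt (NVar 9) (NVar 6))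
    (Seq
      (If (BAnd (BNLt (NVar 7) (NVar 5)) (BNot (BAnd (BNLt (NVar 8) (NVar 6))
             (BRLt (RGet key (NGet 0 (NVar 8))) (RGet key (NGet 0 (NVar 7)))))))
        (Seq (NPut 1 (NVar 9) (NGet 0 (NVar 7)))
             (NSet 7 (NAdd (NVar 7) (NConst 1))))
        (Seq (NPut 1 (NVar 9) (NGet 0 (NVar 8)))
             (NSet 8 (NAdd (NVar 8) (NConst 1)))))
      (NSet 9 (NAdd (NVar 9) (NConst 1))))))).

Definition kle (f : nat -> R) : rel nat := fun x y => (f x <= f y)%R.

(** The loop mirrors the list function [merge]: the prefix written so far, followed by the merge of
    the two rests, never changes. Ties go to the left block as they do there, and sortedness and the
    permutation property are inherited from [merge]. *)
Lemma wp_merge key s a mid hi : nvar s 4 = a -> nvar s 5 = mid ->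
  nvar s 6 = hi -> a <= mid <= hi ->
  wp (mergeC key) (fun t s' => t <= 50 * (hi - a) + 20 /\
     seg (narr s' 1) a hi = merge (kle (rarr s key))
       (seg (narr s 0) a mid) (seg (narr s 0) mid hi)) s.
Proof.
move=> s4 s5 s6 amh; set le := kle _; set o := narr s 0; set M := merge _ _ _.
apply: wp_seq; apply: wp_nset; apply: wp_seq; apply: wp_nset.
apply: wp_seq; apply: wp_nset; rewrite /= /upd /= s4 s5.
pose I T s1 := [/\ T = 50 * (hi - nvar s1 9),
  (a <= nvar s1 7 <= mid) && (mid <= nvar s1 8 <= hi),
  nvar s1 9 + mid = nvar s1 7 + nvar s1 8
  & seg (narr s1 1) a (nvar s1 9) ++
    merge le (seg o (nvar s1 7) mid) (seg o (nvar s1 8) hi) = M].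
apply: (wp_mono _ (wp_while (I := I) (T := 50 * (hi - a)) _ _)).
- move=> t s' [/(_ 6 isT)/= + _ _]; rewrite /upd /= s6 => s'6.
  move=> [tl [T' [_ b7 e9 eM]]]; rewrite /= s'6 -leqNgt => hi9.
  split; first by move: tl => /=; lia.
  by rewrite -eM !(@seg_nil _ o) ?cats0; try lia; congr seg; lia.
- move=> T s1 [frn /(_ 0 isT)/= fra /(_ key isT)/= frr].
  have := frn 6 isT; have := frn 5 isT; rewrite /= /upd /= s5 s6 => s15 s16.
  rewrite -/o in fra.
  move=> [-> b7 e9 eM]; rewrite /= s16 => lt9.
  have ntmp v : seg (upd (narr s1 1) (nvar s1 9) v) a (nvar s1 9).+1
              = rcons (seg (narr s1 1) a (nvar s1 9)) v.
    rewrite seg_rcons; last by lia.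
    rewrite /upd eqxx; congr rcons; apply: eq_seg => i ib.
    by rewrite ifF //; lia.
  apply: wp_seq; apply: wp_if; rewrite /= s15 s16 fra frr => cond;
    apply: wp_seq; apply: wp_nput; apply: wp_nset; apply: wp_nset;
    rewrite /= /upd /= ?addn1;
    (exists (50 * (hi - (nvar s1 9).+1)); last by lia); split => //=;
    rewrite /upd /= ?addn1 ?fra -?/(upd _ _ _) ?ntmp ?cat_rcons; try lia.
  + case/andP: cond => i7; have [j8|j8] /= := ltnP (nvar s1 8) hi => cnd.
      rewrite -eM (@seg_cons _ o (nvar s1 7)) // (@seg_cons _ o (nvar s1 8)) //=.
      have -> : le (o (nvar s1 7)) (o (nvar s1 8)) by rewrite /le /kle leNgt cnd.
      by [].
    have m0 u : merge le u [::] = u by case: u.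
    by rewrite -eM (@seg_nil _ o (nvar s1 8)) // !m0 (@seg_cons _ o (nvar s1 7)).
  + move: cond; have [i7|i7] /= := ltnP (nvar s1 7) mid => cnd.
      move: cnd; rewrite negbK => /andP[j8 cnd].
      rewrite -eM (@seg_cons _ o (nvar s1 7)) // (@seg_cons _ o (nvar s1 8)) //=.
      have -> : le (o (nvar s1 7)) (o (nvar s1 8)) = false.
        by rewrite /le /kle leNgt cnd.
      by [].
    by rewrite -eM !(@seg_nil _ o (nvar s1 7)) //= -seg_cons //; lia.
- by split => /=; rewrite /upd /= ?(@seg_nil _ _ a a) //; lia.
Qed.

End Merge.

(** * All nearest neighbours *)

Section Geometry.
Variable R : realType.
Implicit Types (X Y : nat -> R) (m r : R).
Local Open Scope ring_scope.

(** Distances are compared through their squares, as the machine has no square root; the products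
    have the shape to which [rd2] evaluates. *)
Definition d2 X Y (i j : nat) : R :=
  (X i - X j) * (X i - X j) + (Y i - Y j) * (Y i - Y j).

(* The point at ordinate [Y q] of the line of abscissa [m] is in the open disc of
   squared radius [r] around [p]. *)
Definition near X Y m r (p q : nat) : bool :=
  (Y q - Y p) * (Y q - Y p) + (m - X p) * (m - X p) < r.

Lemma d2_sym X Y i j : d2 X Y i j = d2 X Y j i.
Proof. by rewrite /d2; ring. Qed.

Definition octant (u v : R) : bool * bool * bool :=
  (0 <= u, 0 <= v, `|u| <= `|v|).

Lemma same_sign_sqr (u v : R) : (0 <= u) = (0 <= v) ->
  (u - v) * (u - v) = `|u| * `|u| + `|v| * `|v| - `|u| * `|v| *+ 2.
Proof.
case: (ltP u 0) => u0; case: (ltP v 0) => v0 //= _.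
  by rewrite !ltr0_norm //; ring.
by rewrite !ger0_norm //; ring.
Qed.

(** An octant spans less than 60 degrees. After passage to absolute values, the vector with the
    larger dominant coordinate bounds the difference. *)
Lemma octant_close (u1 u2 v1 v2 : R) : octant u1 u2 = octant v1 v2 ->
  (u1 - v1) * (u1 - v1) + (u2 - v2) * (u2 - v2) <= u1 * u1 + u2 * u2 \/
  (u1 - v1) * (u1 - v1) + (u2 - v2) * (u2 - v2) <= v1 * v1 + v2 * v2.
Proof.
move=> [/same_sign_sqr -> /same_sign_sqr ->].
have sqn (x : R) : x * x = `|x| * `|x| by rewrite -!expr2 real_normK ?num_real.
rewrite (sqn u1) (sqn u2) (sqn v1) (sqn v2).
move: (normr_ge0 u1) (normr_ge0 u2) (normr_ge0 v1) (normr_ge0 v2).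
move: `|u1| `|u2| `|v1| `|v2| => a b c d a0 b0 c0 d0.
case: (leP a b) => ab; case: (leP c d) => cd // _.
  by case: (leP b d) => bd; [right|left]; nra.
by case: (leP a c) => ac; [right|left]; nra.
Qed.

(** If two points in one octant around the projection of [q] both had it in their discs,
    [octant_close] would put one of them inside the disc of the other, although radii do not exceed
    the distances within [s]. *)
Lemma near_count X Y m (nn : nat -> nat) (q : nat) (s : seq nat) : uniq s ->
  {in s &, forall p p', p != p' -> d2 X Y p (nn p) <= d2 X Y p p'} ->
  (count (fun p => near X Y m (d2 X Y p (nn p)) p q) s <= 8)%N.
Proof.
move=> us nns.
have := @count_le_keys _ _ (fun p => octant (X p - m) (Y p - Y q))
  (fun p => near X Y m (d2 X Y p (nn p)) p q) s us.
rewrite !card_prod card_bool; apply => p p' ps p's np np' oct.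
apply: contrapT => /eqP pp'; have p'p : p' != p by rewrite eq_sym.
have := nns _ _ p's ps p'p; have := nns _ _ ps p's pp'.
rewrite (d2_sym _ _ p' p); move: np np'; rewrite /near.
have -> : d2 X Y p p' = ((X p - m) - (X p' - m)) * ((X p - m) - (X p' - m)) +
   ((Y p - Y q) - (Y p' - Y q)) * ((Y p - Y q) - (Y p' - Y q)).
  by rewrite /d2; ring.
move: (d2 X Y p _) (d2 X Y p' _) => r r'.
by case: (octant_close oct) => h; nra.
Qed.

(** This is why a scan may stop at [e]: a point [q] across the line and not before [e] vertically
    is, in each coordinate, at least as far from [p] as the projection of [e]. *)
Lemma near_separated X Y m r p e q :
  (X p <= m <= X q) || (X q <= m <= X p) ->
  (Y p <= Y e <= Y q) || (Y q <= Y e <= Y p) ->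
  ~~ near X Y m r p e -> r <= d2 X Y p q.
Proof.
rewrite /near -leNgt => hx hy /le_trans; apply; rewrite /d2 addrC.
have sq (a b c : R) : (a <= b <= c) || (c <= b <= a) ->
    (b - a) * (b - a) <= (a - c) * (a - c).
  by case/orP => /andP[h1 h2]; nra.
by apply: lerD; apply: sq.
Qed.
End Geometry.

(** * Scanning from a point *)

Definition rdiff (a : nat) (i j : nexp) : rexp := RSub (RGet a i) (RGet a j).
Definition rsqr (e : rexp) : rexp := RMul e e.
Definition rd2 (i j : nexp) : rexp := RAdd (rsqr (rdiff 0 i j)) (rsqr (rdiff 1 i j)).

(* [pos] is an expression in the step number [NVar 8], so that scanning up and
   scanning down are instances of the same loop. *)
Definition scanC (pos bnd : nexp) : cmd :=
  let p := NGet 0 (NVar 9) in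
  let q := NGet 0 pos in
  Seq (NSet 8 (NConst 1))
  (While (BAnd (BNLt (NVar 8) bnd)
     (BRLt (RAdd (rsqr (rdiff 1 q p))
                 (rsqr (RSub (RGet 0 (NGet 2 (NVar 5))) (RGet 0 p))))
           (rd2 p (NGet 3 p))))
    (Seq (If (BRLt (rd2 p q) (rd2 p (NGet 3 p))) (NPut 3 p q) Skip)
         (NSet 8 (NAdd (NVar 8) (NConst 1))))).

Section Scan.
Variable R : realType.
Implicit Types (s : state R).

Lemma near_mono X Y (m r r' : R) p q : (r <= r')%R -> near X Y m r p q -> near X Y m r' p q.
Proof. by move=> rr h; apply: lt_le_trans rr. Qed.

(** Each step is charged to a projection in the initial disc, which contains all later discs because
    the radius only shrinks. The last clause records that a point was either compared with [p], or
    preceded by a projection outside the final disc. *)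
Lemma wp_scan pos bnd f N s :
  (forall s1, nvar s1 9 = nvar s 9 -> nvar s1 4 = nvar s 4 ->
     nvar s1 6 = nvar s 6 -> neval s1 bnd = N /\ neval s1 pos = f (nvar s1 8)) ->
  ncost pos <= 3 -> ncost bnd <= 5 ->
  let X := rarr s 0 in let Y := rarr s 1 in
  let o := narr s 0 in let p := o (nvar s 9) in
  let m := X (narr s 2 (nvar s 5)) in let nn := narr s 3 in
  wp (scanC pos bnd) (fun t s' =>
    let nn' := narr s' 3 in let r' := d2 X Y p (nn' p) in
    [/\ t <= 200 * (\sum_(1 <= i < N) near X Y m (d2 X Y p (nn p)) p (o (f i))) + 200,
        forall x, x != p -> nn' x = nn x,
        nn' p = nn p \/ (exists2 i, 1 <= i < N & nn' p = o (f i)),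
        (r' <= d2 X Y p (nn p))%R
      & forall i, 1 <= i < N -> (r' <= d2 X Y p (o (f i)))%R \/
          (exists2 j, 1 <= j <= i & ~~ near X Y m r' p (o (f j)))]) s.
Proof.
move=> ev cpos cbnd X Y o p m nn.
apply: wp_seq; apply: wp_nset => /=.
pose I T s1 := let nn1 := narr s1 3 in let r1 := d2 X Y p (nn1 p) in
  [/\ 1 <= nvar s1 8,
  T = 200 * (\sum_(nvar s1 8 <= i < N) near X Y m (d2 X Y p (nn p)) p (o (f i))),
  forall x, x != p -> nn1 x = nn x,
  nn1 p = nn p \/ (exists2 i, 1 <= i < N & nn1 p = o (f i))
  & (r1 <= d2 X Y p (nn p))%R /\
    forall i, 1 <= i < nvar s1 8 -> (r1 <= d2 X Y p (o (f i)))%R].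
pose T0 := 200 * (\sum_(1 <= i < N) near X Y m (d2 X Y p (nn p)) p (o (f i))).
apply: (wp_mono _ (wp_while (I := I) (T := T0) _ _)).
- move=> t s' [frn fra frr].
  have := frn 9 isT; have := frn 6 isT; have := frn 5 isT; have := frn 4 isT.
  rewrite /= /upd /= => f4 f5 f6 f9.
  have := fra 0 isT; have := fra 2 isT; rewrite /= -/o => s'2 s'0.
  have := frr 0 isT; have := frr 1 isT; rewrite /= -/X -/Y => s'Y s'X.
  have [evb evp] := ev s' f9 f4 f6; move=> [tl [T' [i1 _ oth nnp [rle rs]]]].
  rewrite /= evb evp !s'2 !s'0 s'X s'Y f5 f9 -/p -/m -/(d2 X Y p _) -/(near X Y m _ p _) => stop.
  split=> //.
    by move: tl => /=; rewrite /T0; set S := \sum_(_ <= _ < _) _; lia.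
  move=> i iN; have [i8|i8] := ltnP i (nvar s' 8); [left|right].
    by apply: rs; lia.
  by exists (nvar s' 8); [lia|move: stop; rewrite (_ : nvar s' 8 < N) //; lia].
- move=> T s1 [frn fra frr].
  have := frn 9 isT; have := frn 6 isT; have := frn 5 isT; have := frn 4 isT.
  rewrite /= /upd /= => f4 f5 f6 f9.
  have := fra 0 isT; have := fra 2 isT; rewrite /= -/o => s'2 s'0.
  have := frr 0 isT; have := frr 1 isT; rewrite /= -/X -/Y => s'Y s'X.
  have [evb evp] := ev s1 f9 f4 f6; move=> [i1 -> oth nnp [rle rs]].
  rewrite /= evb evp !s'2 !s'0 s'X s'Y f5 f9 -/p -/m -/(d2 X Y p _) -/(near X Y m _ p _).
  set q := o (f (nvar s1 8)) => /andP[iN cnd].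
  set S := \sum_(_ <= _ < _) _.
  have eS : S = 1 + \sum_((nvar s1 8).+1 <= i < N)
      near X Y m (d2 X Y p (nn p)) p (o (f i)).
    by rewrite /S big_ltn // -/q (near_mono rle cnd).
  apply: wp_seq; apply: wp_if;
    rewrite /= evp !s'0 s'X s'Y f9 -/p -/q -/(d2 X Y p q) -/(d2 X Y p _) => dq.
  + apply: wp_nput; apply: wp_nset; rewrite /= evp !s'0 f9 -/p -/q.
    rewrite eS; exists (200 * \sum_((nvar s1 8).+1 <= i < N)
      near X Y m (d2 X Y p (nn p)) p (o (f i))); last by lia.
    split; rewrite /= /upd /= ?addn1 ?eqxx //.
    * by move=> x xp; rewrite (negbTE xp) oth.
    * by right; exists (nvar s1 8) => //; lia.
    * split; first by apply: le_trans rle; exact: ltW.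
      move=> i ib; have [i8|i8] := ltnP i (nvar s1 8).
        by apply: (le_trans (ltW dq)); apply: rs; lia.
      by have -> : i = nvar s1 8 by lia.
  + apply: wp_skip; apply: wp_nset; rewrite /=.
    rewrite eS; exists (200 * \sum_((nvar s1 8).+1 <= i < N)
      near X Y m (d2 X Y p (nn p)) p (o (f i))); last by lia.
    split; rewrite /= /upd /= ?addn1 ?eqxx //; split => //.
    move=> i ib; have [i8|i8] := ltnP i (nvar s1 8).
      by apply: rs; lia.
    have -> : i = nvar s1 8 by lia.
    by rewrite leNgt.
- split; rewrite /= /upd //=; first by left.
  by split => // i; lia.
Qed.

End Scan.

(** The bounds on the step number are exclusive; the added 1 lets the downward scan reach the first
    position of the block. *)
Definition hookC : cmd :=
  Seq (NSet 9 (NVar 4))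
  (While (BNLt (NVar 9) (NVar 6))
    (Seq (scanC (NAdd (NVar 9) (NVar 8)) (NSub (NVar 6) (NVar 9)))
    (Seq (scanC (NSub (NVar 9) (NVar 8))
                (NSub (NAdd (NVar 9) (NConst 1)) (NVar 4)))
         (NSet 9 (NAdd (NVar 9) (NConst 1)))))).

Section Hook.
Variable R : realType.
Implicit Types (s : state R).

Lemma sum_up (g : nat -> nat) k hi : k < hi ->
  \sum_(1 <= i < hi - k) g (k + i) = \sum_(k.+1 <= e < hi) g e.
Proof.
move=> khi; rewrite -(addn1 k) addnC big_addn.
by apply: eq_bigr => i _; rewrite addnC.
Qed.

Lemma sum_down (g : nat -> nat) k a : a <= k ->
  \sum_(1 <= i < k + 1 - a) g (k - i) = \sum_(a <= e < k) g e.
Proof.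
move=> ak; rewrite [RHS]big_nat_rev /=.
rewrite -{2}[a]add0n big_addn.
have -> : k + 1 - a = (k - a).+1 by lia.
rewrite big_add1 /=; apply: eq_big_nat => i ib; congr g; lia.
Qed.

Lemma sum_seg_count (P : pred nat) (o : nat -> nat) a hi :
  \sum_(a <= k < hi) P (o k) = count P (seg o a hi).
Proof.
rewrite -sum1_count big_map [RHS]big_mkcond /=.
by apply: eq_bigr => i _; case: (P _).
Qed.

(* Double counting: the scans of all points [p] are charged to the points [q]. *)
Lemma sum_near (P : nat -> nat -> bool) (o : nat -> nat) a hi N :
  (forall q, count (fun p => P p q) (seg o a hi) <= N) ->
  \sum_(a <= k < hi) \sum_(a <= e < hi) P (o k) (o e) <= N * (hi - a).
Proof.
move=> h; rewrite exchange_big /= mulnC -sum_nat_const_nat leq_sum // => e _.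
by rewrite (sum_seg_count (fun p => P p (o e))).
Qed.

(** [L] and [L'] are the blocks on the two sides of the line, before they were merged by
    ordinate. *)
Lemma wp_hook s (L L' : seq nat) :
  let a := nvar s 4 in let hi := nvar s 6 in
  let X := rarr s 0 in let Y := rarr s 1 in let o := narr s 0 in
  let m := X (narr s 2 (nvar s 5)) in let nn := narr s 3 in
  a <= hi ->
  uniq (seg o a hi) -> sorted (kle Y) (seg o a hi) ->
  perm_eq (seg o a hi) (L ++ L') ->
  {in L, forall p, (X p <= m)%R} -> {in L', forall p, (m <= X p)%R} ->
  {in L &, forall p q, p != q -> (d2 X Y p (nn p) <= d2 X Y p q)%R} ->
  {in L' &, forall p q, p != q -> (d2 X Y p (nn p) <= d2 X Y p q)%R} ->
  wp hookC (fun t s' => let nn' := narr s' 3 in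
    [/\ t <= 4000 * (hi - a) + 20,
        forall p, p \notin seg o a hi -> nn' p = nn p,
        {in seg o a hi, forall p,
           nn' p = nn p \/ (nn' p \in seg o a hi /\ nn' p != p)}
      & {in seg o a hi &, forall p q, p != q ->
           (d2 X Y p (nn' p) <= d2 X Y p q)%R}]) s.
Proof.
move=> a hi X Y o m nn ahi us so pe XL XL' nnL nnL'.
pose near0 p q := near X Y m (d2 X Y p (nn p)) p q.
have cnt q : count (fun p => near0 p q) (seg o a hi) <= 16.
  have uL : uniq (L ++ L') by rewrite -(perm_uniq pe).
  rewrite (permP pe) count_cat (@leq_add _ _ 8 8) //.
    by apply: near_count nnL; move: uL; rewrite cat_uniq => /and3P[].
  by apply: near_count nnL'; move: uL; rewrite cat_uniq => /and3P[].
have oinj i j : a <= i < hi -> a <= j < hi -> o i = o j -> i = j.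
  by apply: uniq_seg_inj.
have osort i j : a <= i <= j -> j < hi -> (Y (o i) <= Y (o j))%R.
  by apply: (sorted_seg _ _ so) => [x y z|x]; [apply: le_trans|apply: lexx].
(* A single point may have a long scan, so its cost stays a sum over the initial discs, and only the
   total is bounded, by [sum_near]. The constant 700 covers the fixed costs of two scans and of the
   loop. *)
pose inc k := \sum_(a <= e < hi) near0 (o k) (o e).
pose c k := 200 * inc k + 700.
apply: wp_seq; apply: wp_nset; rewrite /= -/a.
pose I T s1 := let nn1 := narr s1 3 in
  [/\ T = \sum_(nvar s1 9 <= k < hi) c k, a <= nvar s1 9 <= hi,
   forall x, (forall i, a <= i < nvar s1 9 -> x != o i) -> nn1 x = nn x,
   forall i, a <= i < nvar s1 9 -> nn1 (o i) = nn (o i) \/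
     (nn1 (o i) \in seg o a hi /\ nn1 (o i) != o i)
 & forall i q, a <= i < nvar s1 9 -> q \in seg o a hi -> o i != q ->
     (d2 X Y (o i) (nn1 (o i)) <= d2 X Y (o i) q)%R].
apply: (wp_mono _ (wp_while (I := I) (T := \sum_(a <= k < hi) c k) _ _)).
- move=> t s' [/(_ 6 isT)/= f6 _ _] [tl [T' [_ b9 I1 I2 I3]] stop].
  rewrite /upd /= -/hi in f6; move: stop; rewrite /= f6 -leqNgt => stop.
  have e9 : nvar s' 9 = hi by lia.
  rewrite e9 in I1 I2 I3; split.
  + move: tl; rewrite /c big_split /= -big_distrr /= sum_nat_const_nat.
    have := @sum_near near0 o a hi 16 cnt; rewrite /inc.
    by set S := \sum_(_ <= _ < _) _; lia.
  + move=> p ps; apply: I1 => i ib; apply: contraNneq ps => ->.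
    by apply/mem_seg; exists i.
  + by move=> p /mem_seg[i ib ->]; apply: I2.
  + by move=> p q /mem_seg[i ib ->] qs; apply: I3.
- move=> T s1 [frn fra frr] [-> b9 I1 I2 I3].
  have := frn 4 isT; have := frn 5 isT; have := frn 6 isT.
  rewrite /= /upd /= -/a -/hi => f6 f5 f4.
  have := fra 0 isT; have := fra 2 isT; rewrite /= -/o => a2 a0.
  have := frr 0 isT; have := frr 1 isT; rewrite /= -/X -/Y => rY rX.
  rewrite /= f6; set k := nvar s1 9 in b9 I1 I2 I3 * => khi.
  set p := o k.
  have ps : p \in seg o a hi by apply/mem_seg; exists k => //; lia.
  have nnp : narr s1 3 p = nn p.
    by apply: I1 => i ib; apply/eqP => /oinj; lia.
  apply: wp_seq.
  have := @wp_scan _ (NAdd (NVar 9) (NVar 8)) (NSub (NVar 6) (NVar 9))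
    (addn k) (hi - k) s1 _ isT isT.
  rewrite /= a0 a2 rX rY f5 -/k -/p -/m nnp => H; apply: wp_mono (H _).
  + move=> t2 s2 {H} [frn2 fra2 frr2] [tl2 oth2 nnp2 rle2 scan2].
    have := frn2 4 isT; have := frn2 5 isT; have := frn2 6 isT; have := frn2 9 isT.
    rewrite f4 f5 f6 -/k => f92 f62 f52 f42.
    have := fra2 0 isT; have := fra2 2 isT; rewrite a2 a0 => a22 a20.
    have := frr2 0 isT; have := frr2 1 isT; rewrite rX rY => rY2 rX2.
    apply: wp_seq.
    have := @wp_scan _ (NSub (NVar 9) (NVar 8))
      (NSub (NAdd (NVar 9) (NConst 1)) (NVar 4))
      (subn k) (k + 1 - a) s2 _ isT isT.
    rewrite /= a20 a22 rX2 rY2 f52 f92 -/p -/m => H; apply: wp_mono (H _).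
    * move=> t3 s3 {H} [frn3 _ _] [tl3 oth3 nnp3 rle3 scan3].
      apply: wp_nset; rewrite /= (frn3 9 isT) f92 addn1.
      exists (\sum_(k.+1 <= k' < hi) c k').
        clear tl2 tl3; split; rewrite /= /upd /=; [by []|lia|..].
        -- move=> x xi; have xp : x != p by apply: xi; lia.
           by rewrite oth3 // oth2 // I1 // => i ib; apply: xi; lia.
        -- move=> i ib; have [->|ik] := eqVneq i k.
             rewrite -/p; case: nnp3 => [->|[j jb ->]]; last first.
               right; split; first by apply/mem_seg; exists (k - j) => //; lia.
               by apply/eqP => /oinj; lia.
             case: nnp2 => [->|[j jb ->]]; [by left|right].
             split; first by apply/mem_seg; exists (k + j) => //; lia.
             by apply/eqP => /oinj; lia.
           have ip : o i != p by apply/eqP => /oinj; lia.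
           by rewrite oth3 // oth2 //; apply: I2; lia.
        -- move=> i q ib qs; have [->|ik] := eqVneq i k; last first.
             have ip : o i != p by apply/eqP => /oinj; lia.
             by rewrite oth3 // oth2 //; apply: I3 => //; lia.
           rewrite -/p => pq.
           have mem x : x \in seg o a hi = (x \in L) || (x \in L').
             by rewrite (perm_mem pe) mem_cat.
           (* On the side of [p], the initial candidate is already close enough. Across the line,
              the scan towards [q] either reaches [q] or stops at a projection to which
              [near_separated] applies. *)
           have side : ((X p <= m <= X q) || (X q <= m <= X p))%R \/
               (d2 X Y p (nn p) <= d2 X Y p q)%R.
             move: ps qs; rewrite !mem => /orP[] pL /orP[] qL.
             ++ by right; apply: nnL.
             ++ by left; rewrite XL // XL'.
             ++ by left; rewrite (XL _ qL) (XL' _ pL) orbT.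
             ++ by right; apply: nnL'.
           case: side => [side|]; last first.
             by apply: le_trans; apply: le_trans rle3 rle2.
           case/mem_seg: qs pq side => e eb -> pe' side.
           have ek : e <> k by move=> ek; rewrite ek eqxx in pe'.
           have [lek|lek] := ltnP e k.
             case: (scan3 (k - e)); first by clear -lek eb; lia.
               by have -> : k - (k - e) = e by clear -lek; lia.
             move=> [j jb nj]; apply: (near_separated side _ nj).
             by apply/orP; right; rewrite !osort //; clear -jb lek b9 khi eb; lia.
           case: (scan2 (e - k)); first by clear -lek eb ek; lia.
             have -> : k + (e - k) = e by clear -lek; lia.
             exact: le_trans.
           move=> [j jb nj]; apply: (le_trans rle3); apply: (near_separated side _ nj).
           by apply/orP; left; rewrite !osort //; clear -jb lek b9 khi eb; lia.
      (* The second scan starts with the radius left by the first one; as this is no larger, the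
         cost can be charged to the initial disc. *)
      have dn : \sum_(1 <= i < k + 1 - a) near X Y m (d2 X Y p (narr s2 3 p)) p (o (k - i))
            <= \sum_(a <= e < k) near0 p (o e).
        rewrite -(@sum_down (fun e => near0 p (o e) : nat)); last by lia.
        apply: leq_sum => i _; case nr : (near _ _ _ _ _ _) => //.
        by rewrite /near0 (near_mono rle2 nr).
      have := @sum_up (fun e => near0 p (o e) : nat) k hi khi.
      move=> up.
      rewrite (big_ltn khi) {2}/c /inc -/p.
      have -> : \sum_(a <= e < hi) near0 p (o e) =
          \sum_(a <= e < k) near0 p (o e) + (near0 p p + \sum_(k.+1 <= e < hi) near0 p (o e)).
        by rewrite (@big_cat_nat _ _ _ k a hi) /=; [|lia|lia]; rewrite (big_ltn khi).
      have {}tl2 : t2 <= 200 * \sum_(1 <= i < hi - k) near0 p (o (k + i)) + 200.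
        exact: tl2.
      move: tl2 tl3 dn up.
      move: (\sum_(_ <= _ < _) c _) (\sum_(1 <= _ < k + 1 - a) _)
        (\sum_(1 <= _ < hi - k) _) (\sum_(a <= _ < k) _) (\sum_(k.+1 <= _ < hi) _).
      by clear; move=> S1 S2 S3 S4 S5; lia.
    * by move=> s3 /= -> -> _; rewrite f42.
  + by move=> s2 /= -> _ ->; rewrite f6.
- split; rewrite /= /upd //=; first (by lia);
    by [move=> i; lia|move=> i q; lia].
Qed.

End Hook.

(** * The two merge sorts *)

Definition mergeBackC (key : nat) : cmd :=
  Seq (mergeC key) (copyC 0 1 (NVar 4) 6).

Definition initC : cmd :=
  Seq (NSet 9 (NConst 0))
  (While (BNLt (NVar 9) (NVar 0))
    (Seq (NPut 0 (NVar 9) (NVar 9)) (NSet 9 (NAdd (NVar 9) (NConst 1))))).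

(** Array 3 starts as zero, so the first candidate of every point is the point 0; storing 1 for the
    point 0 itself makes all candidates proper. The second sweep starts from the order by abscissa,
    so vertical lines separate its blocks. *)
Definition annC : cmd :=
  Seq initC
  (Seq (sweepC (mergeBackC 0))
  (Seq (copyC 2 0 (NConst 0) 0)
  (Seq (NPut 3 (NConst 0) (NConst 1))
       (sweepC (Seq (mergeBackC 1) hookC))))).

Section ANN.
Variable R : realType.
Implicit Types (s : state R).

Lemma kle_total (f : nat -> R) : total (kle f).
Proof. by move=> x y; apply: le_total. Qed.

Lemma kle_trans (f : nat -> R) : transitive (kle f).
Proof. by move=> y x z; apply: le_trans. Qed.

Lemma kle_refl (f : nat -> R) : reflexive (kle f).
Proof. by move=> x; apply: lexx. Qed.

Lemma wp_mergeBack key s a mid hi : nvar s 4 = a -> nvar s 5 = mid ->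
  nvar s 6 = hi -> a <= mid <= hi ->
  let le := kle (rarr s key) in let o := narr s 0 in
  sorted le (seg o a mid) -> sorted le (seg o mid hi) ->
  wp (mergeBackC key) (fun t s' => let o' := narr s' 0 in
    [/\ t <= 70 * (hi - a) + 40,
        sorted le (seg o' a hi),
        perm_eq (seg o' a hi) (seg o a mid ++ seg o mid hi)
      & forall i, ~~ (a <= i < hi) -> o' i = o i]) s.
Proof.
move=> s4 s5 s6 amh le o so1 so2; apply: wp_seq.
apply: wp_mono (@wp_merge _ key s a mid hi s4 s5 s6 amh) => t1 s1 [frn fra _] [t1le e1].
have := frn 4 isT; have := frn 6 isT; rewrite s4 s6 => f6 f4.
have := fra 0 isT; rewrite -/o => a0.
have ah : neval s1 (NVar 4) <= nvar s1 6 by rewrite /= f4 f6; lia.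
apply: wp_mono (@wp_copy _ 0 1 (NVar 4) 6 s1 isT isT isT ah) => t2 s2 _ /=.
rewrite f4 f6 => -[t2le e2].
have e3 : seg (narr s2 0) a hi = merge le (seg o a mid) (seg o mid hi).
  by rewrite -e1; apply: eq_seg => i ib; rewrite e2 ib.
split.
- by lia.
- by rewrite e3 merge_sorted //; exact: kle_total.
- by rewrite e3 perm_merge.
- by move=> i ib; rewrite e2 (negbTE ib) a0.
Qed.

Lemma wp_init s : wp initC (fun t s' => t <= 20 * nvar s 0 + 20 /\
   forall i, i < nvar s 0 -> narr s' 0 i = i) s.
Proof.
apply: wp_seq; apply: wp_nset => /=; set n := nvar s 0.
pose I T s1 := [/\ T = 20 * (n - nvar s1 9), nvar s1 9 <= n
  & forall i, i < nvar s1 9 -> narr s1 0 i = i].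
apply: (wp_mono _ (wp_while (I := I) (T := 20 * n) _ _)).
- move=> t s' [/(_ 0 isT) + _ _]; rewrite /= /upd /= -/n => f0.
  move=> [tl [T [_ b9 e]]]; rewrite /= f0 -leqNgt => n9.
  by split; [move: tl => /=; lia|move=> i ib; apply: e; lia].
- move=> T s1 [/(_ 0 isT) + _ _]; rewrite /= /upd /= -/n => f0.
  move=> [-> b9 e]; rewrite f0 => lt9.
  apply: wp_seq; apply: wp_nput; apply: wp_nset; rewrite /= /upd /= addn1.
  exists (20 * (n - (nvar s1 9).+1)); last by lia.
  split; rewrite /= /upd /= //.
  by move=> i ib; case: eqP => [->//|ni]; apply: e; lia.
- by split; rewrite /= /upd /= ?subn0.
Qed.

Lemma wp_sortX s : let n := nvar s 0 in let X := rarr s 0 in 1 < n ->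
  (forall i, i < n -> narr s 0 i = i) ->
  wp (sweepC (mergeBackC 0)) (fun t s' =>
    [/\ t <= 600 * n * trunc_log 2 n + 10, sorted (kle X) (seg (narr s' 0) 0 n)
      & perm_eq (seg (narr s' 0) 0 n) (index_iota 0 n)]) s.
Proof.
move=> n X n1 o1.
pose G (na : nat -> nat -> nat) (ra : nat -> nat -> R) := ra 0 = X.
pose B a b (na : nat -> nat -> nat) := sorted (kle X) (seg (na 0) a b) /\
  perm_eq (seg (na 0) a b) (index_iota a b).
(* A merge takes at most [70 * (hi - a) + 40] units, for which 90 per position suffice because
   [hi - a] is at least 2. *)
apply: wp_mono (@wp_sweep _ n 90 (mergeBackC 0) G B _ _ s erefl n1 erefl _).
- move=> t s' _ [tl _ [so pe]]; split=> //.
  by apply: leq_trans tl _; rewrite leq_add2r !leq_mul.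
- by move=> x x7; do 7?[case: x x7 => [|x] x7; first by vm_compute].
- move=> s1 a mid hi s0 s4 s5 s6 amh hn G1 [so1 pe1] [so2 pe2].
  have rX : rarr s1 0 = X by [].
  have amh' : a <= mid <= hi by lia.
  have := @wp_mergeBack 0 s1 a mid hi s4 s5 s6 amh'.
  rewrite /= rX => /(_ so1 so2) H; apply: wp_mono H => t s' [_ _ fr].
  move=> [tl so pe oth]; split => //.
  + by lia.
  + by rewrite /G fr.
  + split=> //; apply: (perm_trans pe).
    have -> : index_iota a hi = index_iota a mid ++ index_iota mid hi.
      by have := @seg_cat nat id a mid hi amh'; rewrite /seg !map_id.
    exact: perm_cat.
  + move=> b c bc bcd [so3 pe3].
    have -> : B b c (narr s') = B b c (narr s1).
      by rewrite /B (@eq_seg _ (narr s' 0) (narr s1 0)) // => i ib; apply: oth; lia.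
    by [].
- move=> i im; rewrite /B seg_cons // seg_nil //= o1 //.
  by rewrite /index_iota subSn // subnn.
Qed.

(** A block keeps the points that its positions have in the order [xo] by abscissa. Hence the first
    point of the right block in [xo] provides the separating line, even after the blocks are
    rearranged by ordinate. *)
Lemma wp_sortY s : let n := nvar s 0 in let X := rarr s 0 in let Y := rarr s 1 in
  let xo := narr s 2 in
  1 < n -> (forall i, i < n -> narr s 0 i = xo i) ->
  sorted (kle X) (seg xo 0 n) -> perm_eq (seg xo 0 n) (index_iota 0 n) ->
  (forall p, p < n -> narr s 3 p < n /\ narr s 3 p != p) ->
  wp (sweepC (Seq (mergeBackC 1) hookC)) (fun t s' =>
    t <= 2 * (4200 + 100) * n * trunc_log 2 n + 10 /\
    forall p, p < n -> [/\ narr s' 3 p < n, narr s' 3 p != p &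
      forall q, q < n -> p != q -> (d2 X Y p (narr s' 3 p) <= d2 X Y p q)%R]) s.
Proof.
move=> n X Y xo n1 oxo soX pX nn0.
pose G (na : nat -> nat -> nat) (ra : nat -> nat -> R) :=
  [/\ ra 0 = X, ra 1 = Y, na 2 = xo, perm_eq (seg (na 0) 0 n) (index_iota 0 n)
    & forall p, p < n -> na 3 p < n /\ na 3 p != p].
pose B a b (na : nat -> nat -> nat) :=
  [/\ sorted (kle Y) (seg (na 0) a b),
      perm_eq (seg (na 0) a b) (seg xo a b)
    & {in seg (na 0) a b &, forall p q, p != q -> (d2 X Y p (na 3 p) <= d2 X Y p q)%R}].
have xole i j : i <= j -> j < n -> (X (xo i) <= X (xo j))%R.
  by move=> ij jn; apply: (sorted_seg (@kle_trans X) (@kle_refl X) soX); rewrite ?ij.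
apply: wp_mono (@wp_sweep _ n 4200 (Seq (mergeBackC 1) hookC) G B _ _ s erefl n1 _ _).
- move=> t s' _ [tl [_ _ _ pe' nb] [_ pe nn]]; split=> //.
  have mem p : p < n -> p \in seg (narr s' 0) 0 n.
    by rewrite (perm_mem pe') mem_index_iota.
  move=> p pn; have [? ?] := nb p pn; split=> // q qn pq.
  by apply: nn; rewrite ?mem.
- by move=> x x7; do 7?[case: x x7 => [|x] x7; first by vm_compute].
- move=> s1 a mid hi s0 s4 s5 s6 amh hn [rX rY xo1 pe0 nb] [so1 pe1 nn1] [so2 pe2 nn2].
  have amh' : a <= mid <= hi by lia.
  have ah : 0 < hi - a by lia.
  have c1 : 0 <= a <= n by lia.
  have c2 : a <= hi <= n by lia.
  have ltn_hi i : a <= i < hi -> i < n by clear -hn; lia.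
  have in_hi i : a <= i < hi -> 0 <= i < n by clear -hn; lia.
  have out_lo i : 0 <= i < a -> ~~ (a <= i < hi) by clear; lia.
  have out_hi i : hi <= i < n -> ~~ (a <= i < hi) by clear; lia.
  apply: wp_seq.
  have := @wp_mergeBack 1 s1 a mid hi s4 s5 s6 amh'.
  rewrite /= rY => /(_ so1 so2) H; apply: wp_mono H => t s2 [frn fra frr].
  have := frn 4 isT; have := frn 5 isT; have := frn 6 isT; rewrite s4 s5 s6 => f6 f5 f4.
  have := fra 2 isT; have := fra 3 isT; rewrite xo1 => a3 a2.
  have := frr 0 isT; have := frr 1 isT; rewrite rX rY => r1 r0.
  set o := narr s1 0 in so1 pe1 nn1 so2 pe2 nn2 pe0 *.
  move=> [tl so pe oth]; set o2 := narr s2 0 in so pe oth.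
  have pall : perm_eq (seg o2 0 n) (index_iota 0 n).
    apply: perm_trans pe0.
    rewrite (seg_cat o2 c1) (seg_cat o2 c2).
    rewrite (seg_cat o c1) (seg_cat o c2) (seg_cat o amh').
    rewrite (@eq_seg _ o2 o 0 a); last by move=> i ib; apply/oth/out_lo.
    rewrite (@eq_seg _ o2 o hi n); last by move=> i ib; apply/oth/out_hi.
    by rewrite perm_cat2l perm_cat2r.
  have uall : uniq (seg o2 0 n) by rewrite (perm_uniq pall) iota_uniq.
  have memn x : x \in seg o2 a hi -> x < n.
    case/mem_seg => i ib ->; have : o2 i \in seg o2 0 n by apply/mem_seg; exists i => //; apply: in_hi.
    by rewrite (perm_mem pall) mem_index_iota.
  have us : uniq (seg o2 a hi).
    move: uall; rewrite (seg_cat o2 c1) (seg_cat o2 c2).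
    by rewrite !cat_uniq => /and3P[_ _ /and3P[]].
  have := @wp_hook _ s2 (seg o a mid) (seg o mid hi).
  rewrite /= f4 f5 f6 r0 r1 -/o2 a2 a3 => H.
  apply: wp_mono (H _ us so pe _ _ nn1 nn2); last 3 first.
  + by case/andP: c2.
  + move=> p; rewrite (perm_mem pe1) => /mem_seg[i ib ->].
    by apply: xole; clear -ib amh hn; lia.
  + move=> p; rewrite (perm_mem pe2) => /mem_seg[i ib ->].
    by apply: xole; clear -ib amh hn; lia.
  move=> t3 s3 {H} [frn3 fra3 frr3] [tl3 out3 in3 nn3].
  have := fra3 0 isT; have := fra3 2 isT; rewrite a2 -/o2 => b2 b0.
  have := frr3 0 isT; have := frr3 1 isT; rewrite r0 r1 => r31 r30.
  split.
  + by move: tl tl3 ah; clear; move: (hi - a) => z; lia.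
  + split; rewrite ?b0 //.
    move=> p pn; have [ps|ps] := boolP (p \in seg o2 a hi); last first.
      by rewrite out3 //; apply: nb.
    by case: (in3 p ps) => [->|[/memn]]; [apply: nb|].
  + split; rewrite b0 //; apply: (perm_trans pe).
    by rewrite (@seg_cat _ xo a mid hi) // perm_cat.
  + move=> b c bc bcd [so4 pe4 nn4].
    have eo : seg o2 b c = seg o b c by apply: eq_seg => i ib; apply: oth; clear -ib bcd; lia.
    split; rewrite b0 eo // => p q ps qs pq.
    (* The order has no repetitions, so a point of another block is not in the merged one and keeps
       its candidate. *)
    rewrite out3; first exact: nn4.
    move: ps; rewrite -eo => /mem_seg[i ib ->]; apply/negP => /mem_seg[j jb].
    have ibn : 0 <= i < n by clear -ib bcd c2; lia.
    move=> /(uniq_seg_inj uall ibn (in_hi _ jb)) ij.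
    by clear -ib jb bcd ij; lia.
- split=> //; rewrite (@eq_seg _ _ xo) // => i ib; apply: oxo; lia.
- move=> i im; rewrite /B seg_cons // (@seg_nil _ _ i.+1) // oxo //.
  rewrite (@seg_cons _ xo) // (@seg_nil _ xo) //; split=> //.
  by move=> p q; rewrite !inE => /eqP -> /eqP ->; rewrite eqxx.
Qed.

Lemma ann_time n l t1 t2 t3 t4 : 1 < n -> 0 < l -> t1 <= 20 * n + 20 ->
  t2 <= 600 * n * l + 10 -> t3 <= 20 * (n - 0) + 20 ->
  t4 <= 2 * (4200 + 100) * n * l + 10 ->
  t1 + (t2 + (t3 + (3 + t4))) <= 98 * (100 * (n * l)).
Proof.
move=> n1 l0; have : n <= n * l by rewrite leq_pmulr.
by rewrite -!(mulnA _ n); move: (n * l) => z; lia.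
Qed.

Lemma wp_ann s : let n := nvar s 0 in let X := rarr s 0 in let Y := rarr s 1 in
  1 < n -> narr s 3 = (fun=> 0) ->
  wp annC (fun t s' => t <= 98 * (100 * (n * trunc_log 2 n)) /\
    forall p, p < n -> [/\ narr s' 3 p < n, narr s' 3 p != p &
      forall q, q < n -> p != q -> (d2 X Y p (narr s' 3 p) <= d2 X Y p q)%R]) s.
Proof.
move=> n X Y n1 z3; apply: wp_seq; apply: wp_mono (wp_init s).
move=> t1 s1 [fn fa fr]; have := fn 0 isT; have := fa 3 isT; rewrite z3.
have := fr 0 isT; have := fr 1 isT; rewrite -/n -/X -/Y => {fn fa fr} Y1 X1 Z1 N1.
move=> [tl1 o1]; apply: wp_seq; have := @wp_sortX s1.
rewrite /= N1 X1 => /(_ n1 o1) H; apply: wp_mono H => t2 s2 [fn fa fr].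
have := fn 0 isT; have := fa 3 isT; rewrite Z1 N1.
have := fr 0 isT; have := fr 1 isT; rewrite X1 Y1 => {fn fa fr} Y2 X2 Z2 N2.
move=> [tl2 so2 pe2]; apply: wp_seq.
apply: (wp_mono _ (@wp_copy _ 2 0 (NConst 0) 0 s2 isT isT isT isT)).
move=> t3 s3 [fn fa fr].
have := fn 0 isT; have := fa 3 isT; rewrite Z2 N2; have := fa 0 isT.
have := fr 0 isT; have := fr 1 isT; rewrite X2 Y2 => {fn fa fr} Y3 X3 O3 Z3 N3.
rewrite /= => -[tl3 c3]; apply: wp_seq; apply: wp_nput; rewrite /=.
have xo3 i : i < n -> narr s3 2 i = narr s2 0 i by move=> im; rewrite c3 im.
have eseg : seg (narr s3 2) 0 n = seg (narr s2 0) 0 n by apply: eq_seg.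
set s4 := set_narr _ _ _ _; have := @wp_sortY s4.
rewrite /= /upd /= N3 X3 Y3 eseg O3 Z3 => H; apply: wp_mono (H n1 _ so2 pe2 _).
- move=> t4 s5 _ [tl4 nn]; split=> //.
  by apply: ann_time tl1 tl2 tl3 tl4 => //; rewrite trunc_log_gt0.
- by move=> i im; rewrite xo3.
- by case=> [|p] _ /=; split=> //; lia.
Qed.

End ANN.

(** * From nearest neighbours to balanced curves *)

Definition emitC (arr cnt : nat) (v : nexp) : cmd :=
  Seq (RPut arr (NVar cnt) (RGet 0 v))
  (Seq (RPut arr.+1 (NVar cnt) (RGet 1 v))
       (NSet cnt (NAdd (NVar cnt) (NConst 1)))).

Definition pairC (x y : nexp) : cmd := Seq (emitC 2 1 x) (emitC 4 2 y).

(** A third leaf is never stored: the closest two of the three are emitted as a pair, one to each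
    curve, and the remaining one stays. *)
Definition leafC : cmd :=
  let x := NVar 8 in let u := NVar 10 in let v := NVar 11 in
  If (BNLt (NGet 5 (NVar 7)) (NConst 1))
    (NPut 5 (NVar 7) (NAdd x (NConst 1)))
  (If (BNLt (NGet 6 (NVar 7)) (NConst 1))
    (NPut 6 (NVar 7) (NAdd x (NConst 1)))
  (Seq (NSet 10 (NSub (NGet 5 (NVar 7)) (NConst 1)))
  (Seq (NSet 11 (NSub (NGet 6 (NVar 7)) (NConst 1)))
  (Seq (NPut 6 (NVar 7) (NConst 0))
  (If (BAnd (BNot (BRLt (rd2 x v) (rd2 x u))) (BNot (BRLt (rd2 u v) (rd2 x u))))
    (Seq (pairC x u) (NPut 5 (NVar 7) (NAdd v (NConst 1))))
  (If (BNot (BRLt (rd2 u v) (rd2 x v)))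
    (Seq (pairC x v) (NPut 5 (NVar 7) (NAdd u (NConst 1))))
    (Seq (pairC u v) (NPut 5 (NVar 7) (NAdd x (NConst 1)))))))))).

(** The first curve is ahead by at most one vertex. For a star with two leaves, it receives the
    center when it is ahead and the two leaves otherwise. Clearing array 4 marks the center as
    done. *)
Definition finishC (z : nat) : cmd :=
  let j := NVar z in
  let u := NSub (NGet 5 j) (NConst 1) in
  let v := NSub (NGet 6 j) (NConst 1) in
  Seq (If (BNLt (NGet 6 j) (NConst 1))
         (pairC j u)
         (If (BNLt (NVar 2) (NVar 1))
           (Seq (pairC j u) (emitC 4 2 v))
           (Seq (pairC u j) (emitC 2 1 v))))
  (Seq (NPut 5 j (NConst 0)) (Seq (NPut 6 j (NConst 0)) (NPut 4 j (NConst 0)))).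

Section Emit.
Variable R : realType.
Implicit Types (s : state R).
Variables (X Y : nat -> R) (E : R).

Definition pt (i : nat) : plane R := (X i, Y i).

(* A group is an item of the paired walk under construction. *)
Definition group_ok (c : seq nat * seq nat) : Prop :=
  [/\ c.1 != [::], c.2 != [::], size c.1 = 1 \/ size c.2 = 1
    & forall p q, p \in c.1 -> q \in c.2 -> (d2 X Y p q <= E *+ 3)%R].

Definition flat (g : seq (seq nat * seq nat)) : seq nat :=
  flatten (unzip1 g) ++ flatten (unzip2 g).

Lemma count_flat_rcons a g A B :
  count a (flat (rcons g (A, B))) = count a (flat g) + count a A + count a B.
Proof.
by rewrite /flat /unzip1 /unzip2 !map_rcons !flatten_rcons !count_cat /=; lia.
Qed.

(** The groups [g] are not in memory; they witness a paired walk along the outputs. As [E] is a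
    squared length, the bound [E *+ 3] in [group_ok] stands for the factor sqrt 3. *)
Definition emitted g s : Prop :=
  [/\ rarr s 0 = X /\ rarr s 1 = Y,
      output_fst s = map pt (flatten (unzip1 g)),
      output_snd s = map pt (flatten (unzip2 g)),
      (forall c, c \in g -> group_ok c)
    & nvar s 2 <= nvar s 1 <= (nvar s 2).+1].

Definition emit_state arr cnt x s : state R :=
  set_nvar (set_rarr (set_rarr s arr (nvar s cnt) (rarr s 0 x))
    arr.+1 (nvar s cnt) (rarr s 1 x)) cnt (nvar s cnt + 1).

Lemma wp_emit arr cnt v Q s : 1 < arr ->
  Q (2 * ncost v + 10) (emit_state arr cnt (neval s v) s) -> wp (emitC arr cnt v) Q s.
Proof.
move=> arr1 q; apply: wp_seq; apply: wp_rput; apply: wp_seq; apply: wp_rput.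
apply: wp_nset; move: q; rewrite /emit_state /set_rarr /=.
have nv f : neval (State (nvar s) (narr s) (rvar s) f) v = neval s v.
  by elim: v => //= [a e ->|e1 -> e2 ->|e1 -> e2 ->].
have r1 f : upd (rarr s) arr f 1 = rarr s 1.
  by rewrite /upd ifF //; case: arr arr1 => [|[]].
rewrite nv r1.
by have -> : 2 * ncost v + 10 = (1 + (ncost v).+1).+1 + ((1 + (ncost v).+1).+1 + (1 + 1).+2) by lia.
Qed.

Lemma emit_fst_fst s x : output_fst (emit_state 2 1 x s) =
  rcons (output_fst s) (rarr s 0 x, rarr s 1 x).
Proof.
rewrite /output_fst /emit_state /= /upd /= /mkseq iotaD map_cat /= cats1.
rewrite add0n eqxx; congr rcons; apply/eq_in_map => i; rewrite mem_iota => ib.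
by have -> : (i == nvar s 1) = false by lia.
Qed.

Lemma emit_fst_snd s x : output_snd (emit_state 2 1 x s) = output_snd s.
Proof. by []. Qed.

Lemma emit_snd_snd s x : output_snd (emit_state 4 2 x s) =
  rcons (output_snd s) (rarr s 0 x, rarr s 1 x).
Proof.
rewrite /output_snd /emit_state /= /upd /= /mkseq iotaD map_cat /= cats1.
rewrite add0n eqxx; congr rcons; apply/eq_in_map => i; rewrite mem_iota => ib.
by have -> : (i == nvar s 2) = false by lia.
Qed.

Lemma emit_snd_fst s x : output_fst (emit_state 4 2 x s) = output_fst s.
Proof. by []. Qed.

Lemma emitted_rcons g A B s s' : emitted g s -> group_ok (A, B) ->
  rarr s' 0 = X -> rarr s' 1 = Y ->
  output_fst s' = output_fst s ++ map pt A ->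
  output_snd s' = output_snd s ++ map pt B ->
  nvar s' 2 <= nvar s' 1 <= (nvar s' 2).+1 ->
  emitted (rcons g (A, B)) s'.
Proof.
move=> [_ o1 o2 ok _] okAB rX rY e1 e2 le; split=> //.
- by rewrite e1 o1 /unzip1 map_rcons flatten_rcons map_cat.
- by rewrite e2 o2 /unzip2 map_rcons flatten_rcons map_cat.
- by move=> c; rewrite mem_rcons inE => /orP[/eqP ->|/ok].
Qed.

Lemma pair_ok x y : (d2 X Y x y <= E *+ 3)%R -> group_ok ([:: x], [:: y]).
Proof.
by move=> le; split=> //; [left|move=> p q; rewrite !inE => /eqP -> /eqP ->].
Qed.

Definition pair_state x y s := emit_state 4 2 y (emit_state 2 1 x s).

Lemma emitted_pair g x y s : emitted g s -> (d2 X Y x y <= E *+ 3)%R ->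
  emitted (rcons g ([:: x], [:: y])) (pair_state x y s).
Proof.
move=> em le; have [[rX rY] _ _ _ b] := em.
apply: emitted_rcons em (pair_ok le) _ _ _ _ _ => //.
- by rewrite emit_snd_fst emit_fst_fst rX rY cats1.
- by rewrite emit_snd_snd emit_fst_snd /= /upd /= rX rY cats1.
- by rewrite /= /upd /=; lia.
Qed.

Lemma emittedW g s s' : rarr s' = rarr s ->
  nvar s' 1 = nvar s 1 -> nvar s' 2 = nvar s 2 -> emitted g s -> emitted g s'.
Proof.
by move=> er e1 e2; rewrite /emitted /output_fst /output_snd er e1 e2.
Qed.

Lemma wp_pair x y Q s : (forall s1, narr s1 = narr s ->
    (forall z, z != 1 -> nvar s1 z = nvar s z) -> neval s1 y = neval s y) ->
  Q (2 * ncost x + 10 + (2 * ncost y + 10)) (pair_state (neval s x) (neval s y) s) ->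
  wp (pairC x y) Q s.
Proof.
move=> ey q; apply: wp_seq; apply: wp_emit => //; apply: wp_emit => //.
rewrite ey //= => z z1; by rewrite /upd (negbTE z1).
Qed.

Definition buffer (na : nat -> nat -> nat) (j : nat) : seq nat :=
  (if na 5 j is k.+1 then [:: k] else [::]) ++
  (if na 6 j is k.+1 then [:: k] else [::]).

Definition buffer_ok (na : nat -> nat -> nat) (j : nat) : Prop :=
  (na 5 j = 0 -> na 6 j = 0) /\
  forall u, u \in buffer na j -> (d2 X Y u j <= E)%R.

(** The sum is three times the sum of the squared distances to [j], minus the squared norm of
    [x + u + v - 3 j]. So the least of the three terms is at most [E *+ 3]. *)
Lemma three_leaves j x u v : (d2 X Y x j <= E)%R -> (d2 X Y u j <= E)%R ->
  (d2 X Y v j <= E)%R ->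
  (d2 X Y x u + d2 X Y x v + d2 X Y u v <= E *+ 9)%R.
Proof.
move=> hx hu hv.
have -> : (d2 X Y x u + d2 X Y x v + d2 X Y u v =
  (d2 X Y x j + d2 X Y u j + d2 X Y v j) *+ 3 -
  ((X x + X u + X v - X j *+ 3) ^+ 2 + (Y x + Y u + Y v - Y j *+ 3) ^+ 2))%R.
  by rewrite /d2; ring.
have := sqr_ge0 (X x + X u + X v - X j *+ 3)%R.
have := sqr_ge0 (Y x + Y u + Y v - Y j *+ 3)%R.
by move: (_ ^+ 2)%R (_ ^+ 2)%R => A B A0 B0; lra.
Qed.

Lemma wp_add g s : let j := nvar s 7 in let x := nvar s 8 in
  emitted g s -> buffer_ok (narr s) j -> (d2 X Y x j <= E)%R ->
  wp leafC (fun t s' => t <= 600 /\ exists g',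
    [/\ emitted g' s', buffer_ok (narr s') j, narr s' 5 j != 0,
      forall l, l != j -> narr s' 5 l = narr s 5 l /\ narr s' 6 l = narr s 6 l
    & forall a, count a (flat g') + count a (buffer (narr s') j) =
        count a (flat g) + count a (buffer (narr s) j) + a x]) s.
Proof.
move=> j x em [bj0 bjE] xE; have [[rX rY] _ _ _ _] := em.
apply: wp_if; rewrite /= -/j ltnS leqn0 => e5.
  apply: wp_nput; rewrite /= -/j -/x !addn1; split=> //; exists g.
  have e6 := bj0 (eqP e5).
  split=> //.
  - rewrite /buffer_ok /buffer /= /upd /= eqxx e6 /=; split=> // u.
    by rewrite inE => /eqP ->.
  - by rewrite /= /upd /= eqxx.
  - by move=> l lj; rewrite /= /upd /= (negbTE lj).
  - by move=> a; rewrite /buffer /= /upd /= eqxx e6 (eqP e5) /=; lia.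
apply: wp_if; rewrite /= -/j ltnS leqn0 => e6.
  apply: wp_nput; rewrite /= -/j -/x !addn1; split=> //; exists g.
  split=> //.
  - rewrite /buffer_ok /buffer /= /upd /= eqxx /=; split=> [e|u]; first by rewrite e in e5.
    rewrite mem_cat inE => /orP[u5|/eqP -> //]; apply: bjE.
    by rewrite /buffer mem_cat u5.
  - by move=> l lj; rewrite /= /upd /= (negbTE lj).
  - by move=> a; rewrite /buffer /= /upd /= eqxx (eqP e6) /= !count_cat /=; lia.
have [u eu] : exists u, narr s 5 j = u.+1 by case: (narr s 5 j) e5 => // u _; exists u.
have [v ev] : exists v, narr s 6 j = v.+1 by case: (narr s 6 j) e6 => // v _; exists v.
have bufj : buffer (narr s) j = [:: u; v] by rewrite /buffer eu ev.
have uE : (d2 X Y u j <= E)%R by apply: bjE; rewrite bufj !inE eqxx.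
have vE : (d2 X Y v j <= E)%R by apply: bjE; rewrite bufj !inE eqxx orbT.
have tri := three_leaves xE uE vE.
apply: wp_seq; apply: wp_nset; rewrite /= -/j eu subn1 /=.
apply: wp_seq; apply: wp_nset; rewrite /= /upd /= -/j ev subn1 /=.
apply: wp_seq; apply: wp_nput; rewrite /= /upd /= -/j.
set s0 := set_narr _ _ _ _.
have em0 : emitted g s0 by apply: emittedW em.
(* The three cases differ only in the naming of the leaves: [y] and [z] are emitted and [w] is
   kept. *)
suff fin y z w :
   (d2 X Y y z <= E *+ 3)%R -> (d2 X Y w j <= E)%R ->
   (forall a : pred nat, a y + a z + a w = a x + a u + a v) ->
   let s1 := set_narr (pair_state y z s0) 5 j w.+1 in
   exists g', [/\ emitted g' s1, buffer_ok (narr s1) j, narr s1 5 j != 0,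
      forall l, l != j -> narr s1 5 l = narr s 5 l /\ narr s1 6 l = narr s 6 l
    & forall a, count a (flat g') + count a (buffer (narr s1) j) =
        count a (flat g) + count a (buffer (narr s) j) + a x].
  apply: wp_if; rewrite /= /upd /= -/j -/x rX rY -!/(d2 X Y _ _) => c1.
    apply: wp_seq; apply: wp_pair; first by move=> s1 _ /= ->.
    apply: wp_nput; rewrite /= /upd /= -/j -/x !addn1; split=> //.
    apply: (fin x u v) => //.
    by move: c1; rewrite -!leNgt => /andP[c1 c2]; lra.
  apply: wp_if; rewrite /= /upd /= -/j -/x rX rY -!/(d2 X Y _ _) => c2.
    apply: wp_seq; apply: wp_pair; first by move=> s1 _ /= ->.
    apply: wp_nput; rewrite /= /upd /= -/j -/x !addn1; split=> //.
    apply: (fin x v u) => //; last by clear; move=> a; lia.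
    move: c1 c2; rewrite -!leNgt negb_and -!ltNge => /orP[] c1 c2; lra.
  apply: wp_seq; apply: wp_pair; first by move=> s1 _ /= ->.
  apply: wp_nput; rewrite /= /upd /= -/j -/x !addn1; split=> //.
  apply: (fin u v x) => //; last by clear; move=> a; lia.
  move: c1 c2; rewrite negbK -!leNgt negb_and -!ltNge => /orP[] c1 c2; lra.
move=> yz wE cnt s1; exists (rcons g ([:: y], [:: z])); split.
- by apply: emittedW (emitted_pair em0 yz).
- rewrite /buffer_ok /buffer /= /upd /= eqxx /=; split=> // k.
  by rewrite inE => /eqP ->.
- by rewrite /= /upd /= eqxx.
- by move=> l lj; rewrite /= /upd /= (negbTE lj).
- move=> a; rewrite count_flat_rcons bufj /buffer /= /upd /= eqxx /=.
  by have := cnt a; clear; lia.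
Qed.

Lemma wp_finish z g s : 6 < z -> let j := nvar s z in
  emitted g s -> buffer_ok (narr s) j -> narr s 5 j != 0 ->
  wp (finishC z) (fun t s' => t <= 200 /\ exists g',
    [/\ emitted g' s', [/\ narr s' 4 j = 0, narr s' 5 j = 0 & narr s' 6 j = 0],
      forall l, l != j ->
        [/\ narr s' 4 l = narr s 4 l, narr s' 5 l = narr s 5 l & narr s' 6 l = narr s 6 l]
    & forall a, count a (flat g') =
        count a (flat g) + a j + count a (buffer (narr s) j)]) s.
Proof.
move=> z6 j em [_ bjE] e5.
have z1 : (z == 1) = false by lia.
have z2 : (z == 2) = false by lia.
have [[rX rY] _ _ _ bal] := em.
have [u eu] : exists u, narr s 5 j = u.+1 by case: (narr s 5 j) e5 => // u _; exists u.
have uE : (d2 X Y u j <= E)%R by apply: bjE; rewrite /buffer eu inE eqxx.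
have E0 : (0 <= E)%R by apply: le_trans uE; rewrite /d2 addr_ge0 // -expr2 sqr_ge0.
have E3 t : (t <= E -> t <= E *+ 3)%R by move=> tE; lra.
suff fin s1 t1 g1 : t1 <= 100 -> emitted g1 s1 -> narr s1 = narr s ->
    nvar s1 z = j -> (forall a, count a (flat g1) =
        count a (flat g) + a j + count a (buffer (narr s) j)) ->
    wp (Seq (NPut 5 (NVar z) (NConst 0)) (Seq (NPut 6 (NVar z) (NConst 0))
        (NPut 4 (NVar z) (NConst 0)))) (fun t s' => t1 + t <= 200 /\ exists g',
    [/\ emitted g' s', [/\ narr s' 4 j = 0, narr s' 5 j = 0 & narr s' 6 j = 0],
      forall l, l != j ->
        [/\ narr s' 4 l = narr s 4 l, narr s' 5 l = narr s 5 l & narr s' 6 l = narr s 6 l]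
    & forall a, count a (flat g') =
        count a (flat g) + a j + count a (buffer (narr s) j)]) s1.
  apply: wp_seq; apply: wp_if; rewrite /= -/j ltnS leqn0 => e6.
    apply: wp_pair; first by move=> s1 /= -> ->; rewrite ?z1.
    apply: (fin _ _ (rcons g ([:: j], [:: u]))) => //.
    - by rewrite /= -/j eu subn1; apply: emitted_pair => //; rewrite d2_sym E3.
    - by rewrite /= /upd z1 z2.
    - by move=> a; rewrite count_flat_rcons /buffer eu (eqP e6) /=; lia.
  have [v ev] : exists v, narr s 6 j = v.+1 by case: (narr s 6 j) e6 => // v _; exists v.
  have vE : (d2 X Y v j <= E)%R by apply: bjE; rewrite /buffer eu ev !inE eqxx orbT.
  apply: wp_if; rewrite /= => lt21.
    apply: wp_seq; apply: wp_pair; first by move=> s1 /= -> ->; rewrite ?z1.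
    apply: wp_emit => //; rewrite /= /upd z1 z2 -/j eu ev !subn1 /=.
    apply: (fin _ _ (rcons g ([:: j], [:: u; v]))) => //.
    - apply: emitted_rcons em _ _ _ _ _ _ => //.
      + split=> //; first by left.
        move=> p q; rewrite !inE => /eqP -> /orP[] /eqP ->; by rewrite d2_sym E3.
      + by rewrite !emit_snd_fst emit_fst_fst rX rY cats1.
      + by rewrite !emit_snd_snd emit_fst_snd /= /upd /= rX rY -!cats1 -catA.
      + by rewrite /= /upd /=; lia.
    - by rewrite /= /upd z1 z2.
    - by move=> a; rewrite count_flat_rcons /buffer eu ev /=; lia.
  apply: wp_seq; apply: wp_pair; first by move=> s1 /= _ ->; rewrite ?z1.
  apply: wp_emit => //; rewrite /= /upd z1 z2 -/j eu ev !subn1 /=.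
  apply: (fin _ _ (rcons g ([:: u; v], [:: j]))) => //.
  - apply: emitted_rcons em _ _ _ _ _ _ => //.
    + split=> //; first by right.
      by move=> p q; rewrite !inE => /orP[] /eqP -> /eqP ->; rewrite E3.
    + by rewrite emit_fst_fst emit_snd_fst emit_fst_fst /= /upd /= rX rY -!cats1 -catA.
    + by rewrite emit_fst_snd emit_snd_snd emit_fst_snd /= /upd /= rX rY cats1.
    + by rewrite /= /upd /=; lia.
  - by rewrite /= /upd z1 z2.
  - by move=> a; rewrite count_flat_rcons /buffer eu ev /=; lia.
move=> t100 em1 an1 zj cnt; do 2!(apply: wp_seq; apply: wp_nput).
apply: wp_nput; rewrite /= zj; split; first by lia.
exists g1; split=> //.
- by rewrite /= /upd /= eqxx.
- by move=> l lj; rewrite /= /upd /= an1 (negbTE lj).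
Qed.

End Emit.

(** * Greedy matching and stars *)

Definition forC (body : cmd) : cmd :=
  Seq (NSet 9 (NConst 0))
  (While (BNLt (NVar 9) (NVar 0))
    (Seq body (NSet 9 (NAdd (NVar 9) (NConst 1))))).

Definition matchC : cmd :=
  let i := NVar 9 in
  If (BAnd (BNLt (NGet 4 i) (NConst 1)) (BNLt (NGet 4 (NGet 3 i)) (NConst 1)))
    (Seq (NPut 4 i (NAdd (NGet 3 i) (NConst 1)))
         (NPut 4 (NGet 3 i) (NAdd i (NConst 1))))
    Skip.

Definition attachC : cmd :=
  If (BNLt (NGet 4 (NVar 9)) (NConst 1))
    (Seq (NSet 7 (NGet 3 (NVar 9))) (Seq (NSet 8 (NVar 9)) leafC))
    Skip.

(* If only one of two mates has leaves, the other one becomes a leaf of it, and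
   if neither has, they form a pair; otherwise both are centers. *)
Definition starsC : cmd :=
  If (BNLt (NConst 0) (NGet 4 (NVar 9)))
    (Seq (NSet 7 (NSub (NGet 4 (NVar 9)) (NConst 1)))
    (Seq (NSet 8 (NVar 9))
    (Seq (If (BNLt (NGet 5 (NVar 7)) (NConst 1))
            (Seq (NSet 8 (NVar 7)) (NSet 7 (NVar 9)))
            Skip)
    (Seq (If (BNLt (NGet 5 (NVar 8)) (NConst 1))
            (Seq leafC (NPut 4 (NVar 8) (NConst 0)))
            (finishC 8))
         (finishC 7)))))
    Skip.

Definition coverC : cmd := Seq (forC matchC) (Seq (forC attachC) (forC starsC)).

Section Cover.
Variable R : realType.
Implicit Types (s : state R).

Lemma wp_for body n K (I : nat -> state R -> Prop) s :
  ~~ nwrites body 0 -> ~~ nwrites body 9 -> nvar s 0 = n ->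
  (forall i s1 v, I i s1 -> I i (set_nvar s1 9 v)) ->
  I 0 s ->
  (forall i s1, nvar s1 9 = i -> i < n -> frame (forC body) s s1 -> I i s1 ->
     wp body (fun t s2 => t <= K /\ I i.+1 s2) s1) ->
  wp (forC body) (fun t s' => t <= (K + 10) * n + 10 /\ I n s') s.
Proof.
move=> b0 b9 s0 inv I0 step; apply: wp_seq; apply: wp_nset => /=.
pose J T s1 := [/\ T = (K + 10) * (n - nvar s1 9), nvar s1 9 <= n & I (nvar s1 9) s1].
apply: (wp_mono _ (wp_while (I := J) (T := (K + 10) * n) _ _)).
- move=> t s' [/(_ 0)/= + _ _]; rewrite (negbTE b0) => /(_ isT).
  rewrite /upd /= s0 => f0 [tl [T [_ l9 i9]]]; rewrite /= f0 -leqNgt => g9.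
  split; first by move: tl => /=; lia.
  by have <- : nvar s' 9 = n by lia.
- move=> T s1 [fn fa fr] [-> l9 i9]; have := fn 0.
  rewrite /= (negbTE b0) /upd /= s0 => /(_ isT) f0; rewrite f0 => lt9.
  have frm : frame (forC body) s s1.
    split=> [x /norP[x9 xw]|a /norP[_ aw]|a /norP[_ rw]].
    + by rewrite fn //= /upd (negbTE x9).
    + by rewrite fa.
    + by rewrite fr.
  apply: wp_seq; apply: wp_mono (step _ s1 erefl lt9 frm i9) => t s2 [fn2 _ _] [tK i2].
  have n29 : nvar s2 9 = nvar s1 9 by apply: fn2.
  apply: wp_nset; rewrite /= n29 addn1.
  exists ((K + 10) * (n - (nvar s1 9).+1)).
    by split; rewrite /= /upd //=; apply: inv.
  have -> : n - nvar s1 9 = (n - (nvar s1 9).+1).+1 by lia.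
  by rewrite mulnS; lia.
- by split; rewrite /= /upd /= ?subn0 //; apply: inv.
Qed.

(** The changed summands are added on opposite sides, which avoids truncated subtraction. *)
Lemma sum_two (f f' : nat -> nat) n j x : j < n -> x < n -> j != x ->
  (forall l, l < n -> l != j -> l != x -> f' l = f l) ->
  \sum_(l < n) f' l + (f j + f x) = \sum_(l < n) f l + (f' j + f' x).
Proof.
move=> jn xn jx e.
have jx' : Ordinal xn != Ordinal jn by rewrite -val_eqE /= eq_sym.
rewrite (bigD1 (Ordinal jn)) // [\sum_(l < n) f l](bigD1 (Ordinal jn)) //=.
rewrite (bigD1 (Ordinal xn)) // [\sum_(l < n | _) f l](bigD1 (Ordinal xn)) //=.
rewrite (eq_bigr (fun l : 'I_n => f l)); first by lia.
by move=> l /andP[lj lx]; apply: e; rewrite -?val_eqE.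
Qed.

Variables (X Y : nat -> R) (E : R) (n : nat) (nn : nat -> nat).
Hypothesis nnP : forall p, p < n -> [/\ nn p < n, nn p != p & (d2 X Y p (nn p) <= E)%R].

Definition mates (ma : nat -> nat) : Prop :=
  forall k, k < n -> ma k = 0 \/ exists l,
    [/\ ma k = l.+1, l < n, l != k, ma l = k.+1 & (d2 X Y k l <= E)%R].

(** A point passed over while unmatched has a matched nearest neighbour, and this loop never
    releases a mate. So every unmatched point can later become a leaf of a matched one. *)
Lemma wp_match s : nvar s 0 = n -> narr s 3 = nn -> narr s 4 = (fun=> 0) ->
  wp (forC matchC) (fun t s' => let ma := narr s' 4 in
    [/\ t <= 50 * n + 10, mates ma & forall k, k < n -> ma k = 0 -> ma (nn k) != 0]) s.
Proof.
move=> s0 s3 s4.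
pose I i s1 := mates (narr s1 4) /\
  forall k, k < i -> narr s1 4 k = 0 -> narr s1 4 (nn k) != 0.
apply: (wp_mono _ (@wp_for matchC n 40 I s isT isT s0 _ _ _)) => //.
- by move=> t s' _ [tl [mt mk]]; split.
- by split=> // k kn; left; rewrite s4.
- move=> i s1 s19 il [_ /(_ 3 isT) + _] [mt mk]; rewrite s3 => f3.
  have [ni nii nE] := nnP il.
  apply: wp_if; rewrite /= f3 s19 !ltnS !leqn0 => cnd.
    case/andP: cnd => /eqP mi /eqP mn.
    apply: wp_seq; apply: wp_nput; apply: wp_nput; rewrite /= ?f3 ?s19 /upd /= ?f3 ?s19 !addn1.
    have ini : (i == nn i) = false by rewrite eq_sym (negbTE nii).
    split=> //; split.
      move=> k kn; rewrite /= /upd /=.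
      have [->|k1] := eqVneq k (nn i).
        right; exists i; split=> //; first by rewrite eq_sym.
          by rewrite ini eqxx.
        by rewrite d2_sym.
      have [->|k2] := eqVneq k i.
        right; exists (nn i); split=> //; by rewrite ?eqxx.
      case: (mt k kn) => [->|[l [ek ln lk el kE]]]; first by left.
      right; exists l; split=> //.
      rewrite ifF; last by apply/eqP => l1; rewrite l1 mn in el.
      by rewrite ifF //; apply/eqP => l1; rewrite l1 mi in el.
    move=> k; rewrite ltnS leq_eqVlt => /orP[/eqP ->|ki]; rewrite /= /upd /=.
      by rewrite ini eqxx.
    case: ifP => // _; case: ifP => // _ /(mk _ ki).
    by case: ifP => // _; case: ifP.
  apply: wp_skip; split=> //; split=> // k.
  rewrite ltnS leq_eqVlt => /orP[/eqP -> mi|]; last exact: mk.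
  by move: cnd; rewrite mi eqxx.
Qed.

(* The points that [l] accounts for before they are emitted, when the unmatched
   points below [i] have been attached. *)
Definition content i (na : nat -> nat -> nat) (l : nat) : seq nat :=
  if na 4 l == 0 then (if i <= l then [:: l] else [::]) else l :: buffer na l.

(** This is a permutation in the form of counts for all predicates, so that moving points between
    groups and buffers becomes linear arithmetic. *)
Definition accounted i g (na : nat -> nat -> nat) : Prop :=
  forall a : pred nat, count a (flat g) + \sum_(l < n) count a (content i na l)
    = count a (iota 0 n).

(** Attaching [i] to [nn i] affects only the contents of these two points and the emitted groups,
    and the total count is preserved. *)
Lemma wp_attach s : nvar s 0 = n -> narr s 3 = nn -> mates (narr s 4) ->
  (forall k, k < n -> narr s 4 k = 0 -> narr s 4 (nn k) != 0) ->
  narr s 5 = (fun=> 0) -> narr s 6 = (fun=> 0) -> emitted X Y E [::] s ->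
  wp (forC attachC) (fun t s' => t <= 670 * n + 10 /\ exists g,
    [/\ emitted X Y E g s', forall l, l < n -> buffer_ok X Y E (narr s') l
      & accounted n g (narr s')]) s.
Proof.
move=> s0 s3 mt mnn s5 s6 em.
pose I i s1 := exists g,
  [/\ emitted X Y E g s1, forall l, l < n -> buffer_ok X Y E (narr s1) l
    & accounted i g (narr s1)].
apply: (wp_mono _ (@wp_for attachC n 650 I s isT isT s0 _ _ _)).
- by move=> t s' _ [tl H]; split=> //; lia.
- by move=> i s1 v [g [e b c]]; exists g; split=> //; apply: emittedW e.
- exists [::]; split=> //.
    by move=> l ln; rewrite /buffer_ok /buffer s5 s6.
  move=> a; have := sum_seg_count a id 0 n.
  rewrite big_mkord /seg /index_iota map_id subn0 => <-; rewrite add0n /content.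
  apply: eq_bigr => l _; rewrite /buffer s5 s6 /=.
  by case: ifP => _; rewrite /= addn0.
- move=> i s1 s19 il [_ fa _] [g [e b c]].
  have f3 : narr s1 3 = nn by rewrite -s3; apply: fa.
  have f4 : narr s1 4 = narr s 4 by apply: fa.
  have [ni nii nE] := nnP il.
  have other s2 : narr s2 4 = narr s1 4 -> 
     (forall l, l < n -> l != nn i -> narr s2 5 l = narr s1 5 l /\ narr s2 6 l = narr s1 6 l) ->
     forall l a, l < n -> l != nn i -> l != i ->
     count a (content i.+1 (narr s2) l) = count a (content i (narr s1) l).
    move=> e4 e56 l a ln lj li; have [e5 e6] := e56 l ln lj.
    rewrite /content e4 /buffer e5 e6; case: ifP => // _; congr (count _ _).
    by congr (if _ then _ else _); clear -li; lia.
  apply: wp_if; rewrite /= s19 ltnS leqn0 => mi; last first.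
    apply: wp_skip; split=> //; exists g; split=> // a; rewrite -c; congr addn.
    apply: eq_bigr => l _; rewrite /content; case: ifP => // ml; congr (count _ _).
    have li : nat_of_ord l != i by apply: contraNneq mi => <-; rewrite ml.
    by congr (if _ then _ else _); clear -li; lia.
  have mj : narr s1 4 (nn i) != 0 by rewrite f4; apply: mnn => //; rewrite -f4; apply/eqP.
  apply: wp_seq; apply: wp_nset; apply: wp_seq; apply: wp_nset.
  rewrite /= /upd /= s19 f3.
  set s2 := set_nvar _ _ _.
  have em2 : emitted X Y E g s2 by apply: emittedW e.
  have nE2 : (d2 X Y (nvar s2 8) (nvar s2 7) <= E)%R by rewrite /= /upd /=.
  have H := @wp_add _ X Y E g s2 em2 (b _ ni) nE2.
  apply: wp_mono H => t s3' [_ fa3 _]; have := fa3 4 isT; rewrite [narr s2 4]/= => f34.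
  rewrite [nvar s2 7]/= [nvar s2 8]/= /upd /= => -[tl [g' [em' ok' n5' oth' cnt']]].
  split; first by clear -tl; lia.
  exists g'; split=> //.
    move=> l ln; have [->//|lj] := eqVneq l (nn i).
    have [e5 e6] := oth' _ lj; have := b l ln; rewrite /buffer_ok /buffer e5 e6.
    by [].
  move=> a; have := c a; have := cnt' a.
  have := @sum_two (fun l => count a (content i (narr s1) l))
     (fun l => count a (content i.+1 (narr s3') l)) n (nn i) i ni il nii.
  have oth2 l : l < n -> l != nn i -> narr s3' 5 l = narr s1 5 l /\ narr s3' 6 l = narr s1 6 l.
    by move=> _ /oth'.
  move=> /(_ (fun l ln lj li => other s3' f34 oth2 l a ln lj li)).
  have -> : content i (narr s1) (nn i) = nn i :: buffer (narr s1) (nn i).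
    by rewrite /content (negbTE mj).
  have -> : content i (narr s1) i = [:: i] by rewrite /content mi leqnn.
  have -> : content i.+1 (narr s3') (nn i) = nn i :: buffer (narr s3') (nn i).
    by rewrite /content f34 (negbTE mj).
  have -> : content i.+1 (narr s3') i = [::] by rewrite /content f34 mi ltnn.
  move: (\sum_(_ < _) _) (\sum_(_ < _) _) => S1 S2.
  clear; rewrite /=; lia.
Qed.

(** Two mates are always settled together, so the points still marked remain matched among
    themselves; in the end no content is left and all points are emitted. *)
Lemma wp_stars g0 s : nvar s 0 = n -> mates (narr s 4) ->
  emitted X Y E g0 s -> (forall l, l < n -> buffer_ok X Y E (narr s) l) ->
  accounted n g0 (narr s) ->
  wp (forC starsC) (fun t s' => t <= 1100 * n + 10 /\ exists g,
    emitted X Y E g s' /\ perm_eq (flat g) (iota 0 n)) s.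
Proof.
move=> s0 mt0 em0 b0 c0.
pose I i s1 := exists g,
  [/\ emitted X Y E g s1, forall l, l < n -> narr s1 4 l != 0 -> buffer_ok X Y E (narr s1) l,
    accounted n g (narr s1), mates (narr s1 4)
    & forall l, l < i -> narr s1 4 l = 0].
apply: (wp_mono _ (@wp_for starsC n 1050 I s isT isT s0 _ _ _)).
- move=> t s' _ [tl [g [em b c mt z]]]; split; first by lia.
  exists g; split=> //; apply/permP => a; rewrite -c big1 ?addn0 // => l _.
  by rewrite /content z //= leqNgt ltn_ord.
- by move=> i s1 v [g [e b c]]; exists g; split=> //; apply: emittedW e.
- by exists g0; split=> // l ln _; apply: b0.
- move=> i s1 s19 il _ [g [em b c mt z]].
  apply: wp_if; rewrite /= s19 => mi; last first.
    apply: wp_skip; split=> //; exists g; split=> // l.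
    by rewrite ltnS leq_eqVlt => /orP[/eqP ->|/z//]; lia.
  have [k [ei kn ki ek kE]] : exists l,
    [/\ narr s1 4 i = l.+1, l < n, l != i, narr s1 4 l = i.+1 & (d2 X Y i l <= E)%R].
    by case: (mt i il) => // mi0; rewrite mi0 in mi.
  apply: wp_seq; apply: wp_nset; rewrite /= s19 ei subn1 /=.
  apply: wp_seq; apply: wp_nset; rewrite /= /upd /= s19.
  apply: wp_seq.
  (* After the possible swap, [x] has no leaf or [j] has one. Thus [j] has a leaf when it is
     finished: either [x] becomes one, or [x] is emitted with its own leaves and [j] has some
     already. *)
  suff main s2 j x t2 : t2 <= 20 -> narr s2 = narr s1 -> emitted X Y E g s2 ->
     nvar s2 7 = j -> nvar s2 8 = x -> (j = i /\ x = k) \/ (j = k /\ x = i) ->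
     (narr s2 5 x = 0 \/ narr s2 5 j != 0) ->
     wp (Seq (If (BNLt (NGet 5 (NVar 8)) (NConst 1))
            (Seq leafC (NPut 4 (NVar 8) (NConst 0)))
            (finishC 8)) (finishC 7)) (fun t s' => t2 + t + 20 <= 1050 /\ I i.+1 s') s2.
    have em1 a b' : emitted X Y E g (set_nvar (set_nvar s1 7 a) 8 b').
      by apply: emittedW em.
    apply: wp_if; rewrite /= /upd /= ltnS leqn0 => e5.
      apply: wp_seq; apply: wp_nset; apply: wp_nset; rewrite /= /upd /= s19.
      apply: wp_mono; last apply: (main _ i k 10) => //.
      + by move=> t s' _ [tl Is]; split=> //; clear -tl; lia.
      + by left.
      + by left; apply/eqP.
    apply: wp_skip.
    apply: wp_mono; last apply: (main _ k i 10) => //.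
    + by move=> t s' _ [tl Is]; split=> //; clear -tl; lia.
    + by right.
    + by right.
  move=> t20 an em2 s27 s28 jxik e5.
  have [[jn xn] jx xE mj mx] : [/\ j < n /\ x < n, j != x, (d2 X Y x j <= E)%R,
      narr s1 4 j != 0 & narr s1 4 x != 0].
    by case: jxik => -[-> ->]; rewrite ei ek; split=> //; rewrite ?(eq_sym i) // d2_sym.
  have xj : (x == j) = false by rewrite eq_sym (negbTE jx).
  have bj := b j jn mj; have bx := b x xn mx.
  suff fin s3 g3 t3 : t3 <= 800 -> emitted X Y E g3 s3 -> nvar s3 7 = j ->
     narr s3 4 x = 0 -> buffer_ok X Y E (narr s3) j -> narr s3 5 j != 0 ->
     (forall l, l != j -> l != x -> [/\ narr s3 4 l = narr s1 4 l,
        narr s3 5 l = narr s1 5 l & narr s3 6 l = narr s1 6 l]) ->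
     (forall a, count a (flat g3) + a j + count a (buffer (narr s3) j) =
       count a (flat g) + count a (j :: buffer (narr s1) j) +
       count a (x :: buffer (narr s1) x)) ->
     wp (finishC 7) (fun t s' => t2 + (t3 + t) + 20 <= 1050 /\ I i.+1 s') s3.
    apply: wp_seq; apply: wp_if; rewrite /= an s28 ltnS leqn0 => e5x.
      apply: wp_seq.
      have := @wp_add _ X Y E g s2 em2; rewrite s27 s28 an => /(_ bj xE) H.
      apply: wp_mono H => t3 s3 [fn3 fa3 _] [tl [g3 [em3 b3 n53 oth3 cnt3]]].
      have := fn3 7 isT; have := fn3 8 isT; have := fa3 4 isT.
      rewrite an s27 s28 => f4 f8 f7.
      apply: wp_nput; rewrite /= f8.
      apply: (wp_mono _ (fin _ g3 (t3 + 10) _ _ _ _ _ _ _ _)).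
      + by move=> t s' _ [tt Is]; split=> //; clear -tt; lia.
      + by clear -tl; lia.
      + by apply: emittedW em3.
      + by [].
      + by rewrite /= /upd /= eqxx.
      + by [].
      + by [].
      + by move=> l lj lx; rewrite /= /upd /= (negbTE lx) f4; have [-> ->] := oth3 l lj.
      + have bx0 : buffer (narr s1) x = [::].
          by rewrite /buffer (eqP e5x) (proj1 bx (eqP e5x)).
        move=> a; have := cnt3 a; rewrite bx0.
        rewrite -[buffer (narr (set_narr _ _ _ _)) j]/(buffer (narr s3) j).
        by rewrite /=; clear; lia.
    have := @wp_finish _ X Y E 8 g s2 isT em2; rewrite s28 an => /(_ bx e5x) H.
    apply: wp_mono H => t3 s3 [fn3 _ _] [tl [g3 [em3 [z4 z5 z6] oth3 cnt3]]].
    have := fn3 7 isT; rewrite s27 => f7.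
    have [o4 o5 o6] := oth3 _ jx.
    have e5j : narr s1 5 j != 0.
      by rewrite -an; case: e5 => // e5; rewrite -an e5 in e5x.
    apply: (wp_mono _ (fin _ g3 (t3 + 10) _ em3 f7 z4 _ _ _ _)).
    + by move=> t s' _ [tt Is]; split=> //; clear -tt; lia.
    + by clear -tl; lia.
    + by move: bj; rewrite /buffer_ok /buffer o5 o6.
    + by rewrite o5.
    + by move=> l lj lx; apply: oth3.
    + by move=> a; rewrite cnt3 /buffer o5 o6 /=; clear; lia.
  move=> tl3 em3 s37 z4 b3 n53 oth3 cnt3.
  have := @wp_finish _ X Y E 7 g3 s3 isT em3; rewrite s37 => /(_ b3 n53) H.
  apply: wp_mono H => t4 s4 _ [tl4 [g4 [em4 [z44 z54 z64] oth4 cnt4]]].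
  split; first by clear -tl3 tl4 t20; lia.
  have zx : narr s4 4 x = 0 by have [-> _ _] := oth4 x (negbT xj).
  have same l : l != j -> l != x -> [/\ narr s4 4 l = narr s1 4 l,
        narr s4 5 l = narr s1 5 l & narr s4 6 l = narr s1 6 l].
    move=> lj lx; have [-> -> ->] := oth4 l lj; exact: oth3.
  have mt4 l : l < n -> narr s4 4 l != 0 -> l != j /\ l != x.
    by move=> ln l4; split; apply: contraNneq l4 => ->; apply/eqP.
  exists g4; split=> //.
  - move=> l ln l4; have [lj lx] := mt4 l ln l4; have [e4 e5' e6] := same l lj lx.
    by rewrite /buffer_ok /buffer e5' e6; apply: b => //; rewrite -e4.
  - move=> a; have := c a; have := cnt3 a; rewrite -cnt4.
    have other l : l < n -> l != j -> l != x ->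
        count a (content n (narr s4) l) = count a (content n (narr s1) l).
      move=> ln lj lx; have [e4 e5' e6] := same l lj lx.
      by rewrite /content e4 /buffer e5' e6.
    have := @sum_two (fun l => count a (content n (narr s1) l))
       (fun l => count a (content n (narr s4) l)) n j x jn xn jx other.
    have -> : content n (narr s1) j = j :: buffer (narr s1) j.
      by rewrite /content (negbTE mj).
    have -> : content n (narr s1) x = x :: buffer (narr s1) x.
      by rewrite /content (negbTE mx).
    have -> : content n (narr s4) j = [::] by rewrite /content z44 leqNgt jn.
    have -> : content n (narr s4) x = [::] by rewrite /content zx leqNgt xn.
    move: (\sum_(_ < _) _) (\sum_(_ < _) _) => S1 S2.
    clear; rewrite /=; lia.
  - move=> l ln; have [l0|l4] := eqVneq (narr s4 4 l) 0; [by left|right].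
    have [lj lx] := mt4 l ln l4; have [e4 _ _] := same l lj lx.
    case: (mt l ln) => [l0|[q [q1 qn ql q4 qE]]]; first by rewrite e4 l0 in l4.
    exists q; split=> //; first by rewrite e4.
    (* As [j] and [x] are mates of each other, neither is the mate of a third point. *)
    have [qj qx] : q != j /\ q != x.
      by split; apply/eqP => qq; move: q4; rewrite qq;
        case: jxik lj lx => -[-> ->] lj lx; rewrite ?ei ?ek => -[]; apply/eqP; rewrite eq_sym.
    by have [-> _ _] := same q qj qx.
  - move=> l; rewrite ltnS leq_eqVlt => /orP[/eqP ->|li].
      by case: jxik zx z44 => -[-> ->].
    have [->//|lj] := eqVneq l j; have [->//|lx] := eqVneq l x.
    by have [-> _ _] := same l lj lx; apply: z.
Qed.

Lemma wp_cover s : nvar s 0 = n -> rarr s 0 = X -> rarr s 1 = Y -> narr s 3 = nn ->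
  narr s 4 = (fun=> 0) -> narr s 5 = (fun=> 0) -> narr s 6 = (fun=> 0) ->
  nvar s 1 = 0 -> nvar s 2 = 0 ->
  wp coverC (fun t s' => t <= 1820 * n + 30 /\ exists g,
    emitted X Y E g s' /\ perm_eq (flat g) (iota 0 n)) s.
Proof.
move=> s0 sX sY s3 s4 s5 s6 v1 v2; apply: wp_seq.
apply: wp_mono (wp_match s0 s3 s4) => t1 s1 [fn fa fr] [tl1 mt1 mn1].
apply: wp_seq.
apply: (wp_mono _ (@wp_attach s1 _ _ mt1 mn1 _ _ _)).
- move=> t2 s2 [fn2 fa2 _] [tl2 [g [em2 b2 c2]]].
  apply: (wp_mono _ (@wp_stars g s2 _ _ em2 b2 c2)).
  + by move=> t3 s3' _ [tl3 H]; split=> //; clear -tl1 tl2 tl3; lia.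
  + by rewrite (fn2 0 isT) (fn 0 isT).
  + by rewrite (fa2 4 isT).
- by rewrite (fn 0 isT).
- by rewrite (fa 3 isT).
- by rewrite (fa 5 isT).
- by rewrite (fa 6 isT).
- split=> //.
  + by rewrite (fr 0 isT) (fr 1 isT).
  + by rewrite /output_fst (fn 1 isT) v1.
  + by rewrite /output_snd (fn 2 isT) v2.
  + by rewrite (fn 1 isT) (fn 2 isT) v1 v2.
Qed.

End Cover.

(** * The approximation algorithm *)

Section Final.
Variable R : realType.

Lemma dist_sym (p q : plane R) : dist p q = dist q p.
Proof. by rewrite /dist; congr Num.sqrt; ring. Qed.

Lemma bigmax_seq_ge (T : eqType) (r : seq T) (F : T -> R) x :
  x \in r -> (F x <= \big[Num.max/0%R]_(y <- r) F y)%R.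
Proof.
elim: r => // y r IH; rewrite inE big_cons le_max => /orP[/eqP ->|/IH ->].
  by rewrite lexx.
by rewrite orbT.
Qed.

Lemma walk_cost_ge (w : seq (curve R * curve R)) c p q :
  c \in w -> p \in c.1 -> q \in c.2 -> (dist p q <= walk_cost w)%R.
Proof.
move=> cw pc qc; apply: le_trans (bigmax_seq_ge _ cw).
apply: le_trans (bigmax_seq_ge _ pc); exact: bigmax_seq_ge.
Qed.

Lemma walk_cost_le (w : seq (curve R * curve R)) (e : R) : (0 <= e)%R ->
  (forall c p q, c \in w -> p \in c.1 -> q \in c.2 -> (dist p q <= e)%R) ->
  (walk_cost w <= e)%R.
Proof.
move=> e0 h; have m x y : (x <= e -> y <= e -> Num.max x y <= e)%R.
  by rewrite ge_max => -> ->.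
rewrite /walk_cost big_seq; apply: (big_ind (fun y => y <= e)%R) => // c cw.
rewrite big_seq; apply: (big_ind (fun y => y <= e)%R) => // p pc.
rewrite big_seq; apply: (big_ind (fun y => y <= e)%R) => // q qc; exact: h cw pc qc.
Qed.

(** In an optimal walk, the item that contains [p] has a vertex of the other curve, and this is a
    different point because the curves are disjoint. *)
Lemma eps_star_neighbour (S : {fset plane R}) p : (1 < #|` S|) -> p \in S ->
  exists q, [/\ q \in S, q != p & (dist p q <= eps_star S)%R].
Proof.
move=> S2 pS; have [[P [Q [[P0 Q0 _ _ [A [B [AB dAB PA QB]]]] ->]]] _] := eps_star_min S2.
have [[w [w1 w2 wP] <-] _] := ddF_min P0 Q0.
have disj x : x \in P -> x \in Q -> False.
  rewrite PA QB => xA xB; have : x \in (A `&` B)%fset by rewrite in_fsetI xA.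
  by rewrite dAB in_fset0.
have inP c x : c \in w -> x \in c.1 -> x \in P.
  by move=> cw xc; rewrite -w1; apply/flattenP; exists c.1 => //; apply: map_f.
have inQ c x : c \in w -> x \in c.2 -> x \in Q.
  by move=> cw xc; rewrite -w2; apply/flattenP; exists c.2 => //; apply: map_f.
have head (s : curve R) : s != [::] -> exists x, x \in s.
  by case: s => // x s _; exists x; rewrite inE eqxx.
move: pS; rewrite -AB in_fsetU -PA -QB => /orP[] pX.
  move: (pX); rewrite -w1 => /flattenP[_ /mapP[c cw ->] pc].
  have [_ /head[q qc] _] := wP c cw; exists q; split.
  - by rewrite in_fsetU -QB (inQ c) ?orbT.
  - by apply/eqP => qp; apply: (disj p) => //; rewrite -qp (inQ c).
  - exact: walk_cost_ge pc qc.
move: (pX); rewrite -w2 => /flattenP[_ /mapP[c cw ->] pc].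
have [/head[q qc] _ _] := wP c cw; exists q; split.
- by rewrite in_fsetU -PA (inP c).
- by apply/eqP => qp; apply: (disj p) => //; rewrite -qp (inP c).
- by rewrite dist_sym; apply: walk_cost_ge qc pc.
Qed.

Definition approxC : cmd := Seq annC coverC.

Variable pts : seq (plane R).
Hypotheses (upts : uniq pts) (pts2 : 1 < size pts).
Let n := size pts.
Let X i : R := (nth (0, 0)%R pts i).1.
Let Y i : R := (nth (0, 0)%R pts i).2.
Let S : {fset plane R} := [fset p in pts]%fset.

Lemma card_pts : #|` S| = n.
Proof. by rewrite card_fseq undup_id. Qed.

Lemma dist_pt i j : dist (pt X Y i) (pt X Y j) = Num.sqrt (d2 X Y i j).
Proof. by rewrite /dist /d2 -!expr2. Qed.

Lemma pt_nth i : pt X Y i = nth (0, 0)%R pts i.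
Proof. by rewrite /pt /X /Y -surjective_pairing. Qed.

Lemma eps_star_ge0 : (0 <= eps_star S)%R.
Proof.
have p0 : nth (0, 0)%R pts 0 \in S by rewrite in_fset /= mem_nth // ltnW.
have [|q [_ _ /(le_trans _)->//]] := eps_star_neighbour _ p0.
  by rewrite card_pts.
exact: sqrtr_ge0.
Qed.

(** The partner of [p] in an optimal walk competes with the nearest neighbour; this yields the bound
    with [E] the square of [eps_star S]. *)
Lemma nearest_le p (np : nat) : p < n ->
  (forall q, q < n -> p != q -> (d2 X Y p np <= d2 X Y p q)%R) ->
  (d2 X Y p np <= eps_star S ^+ 2)%R.
Proof.
move=> pn h; have pS : pt X Y p \in S by rewrite in_fset /= pt_nth mem_nth.
have [|z [zS zp zd]] := eps_star_neighbour _ pS; first by rewrite card_pts.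
move: zS zp zd; rewrite in_fset /= => /(nthP (0, 0)%R)[q qn <-].
rewrite -pt_nth dist_pt => qp qd.
have pq : p != q by apply: contraNneq qp => ->.
apply: le_trans (h q qn pq) _.
rewrite -(@ler_sqrt _ _ (_ ^+ 2)%R) ?exprn_ge0 ?eps_star_ge0 //.
by rewrite sqrtr_sqr ger0_norm // eps_star_ge0.
Qed.

Lemma emitted_approx g (s : state R) :
  emitted X Y (eps_star S ^+ 2)%R g s -> perm_eq (flat g) (iota 0 n) ->
  balanced_approx S (output_fst s) (output_snd s).
Proof.
move=> [_ oP oQ ok bal] pe.
have pPQ : perm_eq (output_fst s ++ output_snd s) pts.
  rewrite oP oQ -map_cat; apply: perm_trans (perm_map _ pe) _.
  by rewrite (eq_map pt_nth) map_nth_iota0 ?take_size.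
have sP : size (output_fst s) = nvar s 1 by rewrite size_mkseq.
have sQ : size (output_snd s) = nvar s 2 by rewrite size_mkseq.
have sn : nvar s 1 + nvar s 2 = n by rewrite -sP -sQ -size_cat (perm_size pPQ).
have n2 : 1 < n by [].
have P0 : output_fst s != [::] by rewrite -size_eq0 sP; lia.
have Q0 : output_snd s != [::] by rewrite -size_eq0 sQ; lia.
have /and3P[uP dPQ uQ] : [&& uniq (output_fst s),
    ~~ has (mem (output_fst s)) (output_snd s) & uniq (output_snd s)].
  by rewrite -cat_uniq (perm_uniq pPQ).
split.
- split=> //; exists [fset p in output_fst s]%fset, [fset p in output_snd s]%fset.
  split.
  + by apply/fsetP => p; rewrite in_fsetU !in_fset /= -mem_cat (perm_mem pPQ).
  + apply/fsetP => p; rewrite in_fsetI !in_fset /= in_fset0.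
    by apply/negP => /andP[pP pQ]; move/hasP: dPQ; apply; exists p.
  + by move=> p; rewrite in_fset.
  + by move=> p; rewrite in_fset.
- have [_ lb] := ddF_min P0 Q0.
  pose w := [seq (map (pt X Y) c.1, map (pt X Y) c.2) | c <- g].
  have w1 : flatten (unzip1 w) = output_fst s.
    by rewrite oP map_flatten /w /unzip1 -!map_comp.
  have w2 : flatten (unzip2 w) = output_snd s.
    by rewrite oQ map_flatten /w /unzip2 -!map_comp.
  (* The groups, read as points, form a paired walk, whose cost bounds the minimum [ddF] from
     above. *)
  apply: (@le_trans _ _ (walk_cost w)).
    apply: lb; exists w => //; split=> // _ /mapP[c /ok[c1 c2 sz _] ->].
    by rewrite /= -!size_eq0 !size_map !size_eq0.
  apply: walk_cost_le; first by rewrite mulr_ge0 ?sqrtr_ge0 ?eps_star_ge0.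
  move=> _ _ _ /mapP[c /ok[_ _ _ cE] ->] /mapP[p pc ->] /mapP[q qc ->].
  rewrite dist_pt; apply: le_trans (ler_wsqrtr (cE p q pc qc)) _.
  rewrite -[(_ *+ 3)%R]mulr_natl sqrtrM ?ler0n // sqrtr_sqr ger0_norm //.
  exact: eps_star_ge0.
(* The sizes add up to [n] and differ by at most one, so the larger one is [uphalf n]. *)
- rewrite sP sQ card_pts uphalf_half; have := odd_double_half n.
  by rewrite -muln2; case: (odd n); lia.
Qed.

(** Of the factor 120, the nearest neighbours take 98; the linear time of the cover fits into the
    rest because the logarithm is at least 1. *)
Lemma wp_approx : wp approxC (fun t s' => t <= 120 * (100 * nlogn n) /\
  balanced_approx S (output_fst s') (output_snd s')) (input_state pts).
Proof.
apply: wp_seq; apply: wp_mono (wp_ann (s := input_state pts) pts2 erefl).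
move=> t1 s1 [fn fa fr] [tl1 nn1].
have nnP p : p < n -> [/\ narr s1 3 p < n, narr s1 3 p != p &
    (d2 X Y p (narr s1 3 p) <= eps_star S ^+ 2)%R].
  by move=> pn; have [h1 h2 h3] := nn1 p pn; split=> //; apply: nearest_le.
apply: (wp_mono _ (wp_cover (s := s1) nnP _ _ _ erefl _ _ _ _ _)).
- move=> t2 s2 _ [tl2 [g [em pe]]]; split; last exact: emitted_approx em pe.
  have : n <= nlogn n by rewrite /nlogn leq_pmulr // trunc_log_gt0.
  have : 1 < n by [].
  move: tl1; rewrite /nlogn [nvar _ 0]/= /upd /= -/n => tl1.
  by move: tl1 tl2; move: (n * _) => z; clear; lia.
- exact: fn 0 isT.
- exact: fr 0 isT.
- exact: fr 1 isT.
- exact: fa 4 isT.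
- exact: fa 5 isT.
- exact: fa 6 isT.
- exact: fn 1 isT.
- exact: fn 2 isT.
Qed.

End Final.

Theorem theorem21 (R : realType) :
  (forall S : {fset plane R}, (2 <= #|` S|)%N ->
     exists P Q : curve R, balanced_approx S P Q)
  /\
  (exists (prog : cmd) (C : nat),
     forall pts : seq (plane R), uniq pts -> (2 <= size pts)%N ->
       exists (t : nat) (s : state R),
         [/\ exec prog (input_state pts) t s,
             (t <= C * nlogn (size pts))%N
           & balanced_approx [fset p in pts]%fset (output_fst s) (output_snd s)]).
Proof.
split.
  (* Existence is obtained by running the program on the enumeration of [S]. *)
  move=> S S2; have [_ [s [_ [_]]]] := wp_approx (fset_uniq S) S2.
  have enumS (l : seq (plane R)) : l =i S -> [fset p in l]%fset = S.
    by move=> lS; apply/fsetP => p; rewrite in_fset lS.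
  rewrite enumS //.
  by exists (output_fst s), (output_snd s).
exists approxC, (120 * 100) => pts upts pts2.
have [t [s [e [tl ok]]]] := wp_approx upts pts2.
by exists t, s; split=> //; rewrite -mulnA.
Qed.
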